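(* For complex $q$ with $|q|<1$, $$\sum_{n\geq1} \frac{(-1)^{n-1}\, q^{\binom{n+1}2}\, (q;q)_n\,(q;q)_{n-1}}{(q;q)_{2n}} \;=\; \sum_{n\geq1} \frac{\left(\frac{5}{n}\right) q^n}{1-q^n}.$$
   Context: $(a;q)_0=1$ and $(a;q)_n=\prod_{j=0}^{n-1}(1-aq^j)$ for $n\ge1$. $\left(\frac{5}{n}\right)$ is the Kronecker symbol; for positive integers $n$ it equals $1$ if $n\equiv\pm1\pmod 5$, $-1$ if $n\equiv \pm2 \pmod 5$, and $0$ if $5\mid n$. *)

(* Defs.v *)
From HB Require Import structures.
From mathcomp Require Import all_boot all_order all_algebra.
From mathcomp Require Import complex.
From mathcomp Require Import all_classical all_reals all_analysis.
Import Order.TTheory GRing.Theory Num.Theory.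
Import numFieldNormedType.Exports.

Set Implicit Arguments.
Unset Strict Implicit.
Unset Printing Implicit Defensive.

Local Open Scope classical_set_scope.
Local Open Scope ring_scope.

(* [R[i]] carries no canonical topology; packaging it as a numClosedFieldType
   gives it the topology of its norm [`|z|] through numFieldNormedType. *)
Definition Cplx (R : realType) : numClosedFieldType := complex R.

(* (a; q)_n; the empty product gives (a; q)_0 = 1. *)
Definition qpoch (A : pzRingType) (a q : A) (n : nat) : A :=
  \prod_(j < n) (1 - a * q ^+ j).

(* The Kronecker symbol (5/n), through its table of values modulo 5 (the period
   is 5 because 5 is a fundamental discriminant).  In particular (5/0) = 0. *)
Definition kronecker5 (n : nat) : int :=
  if (n %% 5)%N \in [:: 1; 4]%N then 1
  else if (n %% 5)%N \in [:: 2; 3]%N then -1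
  else 0.

(* Main.v *)
(* Both series are equal to the sum of q^(a^2 + 3ab + b^2) over a >= 1, b >= 0.

   For the left-hand side, (q;q)_n / (q;q)_{2n} is expanded as
     sum_{1 <= r <= n} (-1)^(r-1) (1 - q^r) q^C(r,2) S_r / ((q;q)_{n-r} (q;q)_{n+r}),
   with S_r = sum_{0 <= b < r} q^(b(r-b)), which is a Bailey pair relative to 1.
   Inserting this and summing over n first (a conjugate Bailey pair) leaves
   sum_r q^(r^2) S_r, and r^2 + b(r-b) = a^2 + 3ab + b^2 for r = a + b.

   For the right-hand side, a^2 + 3ab + b^2 is the norm of a + b eta in the ring of
   integers Z[eta] of Q(sqrt 5), and a >= 1, b >= 0 is a fundamental domain for the
   totally positive elements modulo units.  The number A(n) of points of norm n and
   the divisor sum of the Kronecker symbol chi satisfy the same recurrence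
     A(pn) = (1 + chi(p)) A(n) - chi(p) A(n/p)
   for every prime p: if chi(p) = 1 then p is the norm of some pi, and the elements
   of norm pn are divisible by pi or by its conjugate; if chi(p) = -1 they are
   divisible by p; and p = 5 is the norm of 1 + eta.

   Analytically, both partial sums up to M differ from sum_{m <= M} A(m) q^m by
   O(M^3 |q|^M). *)
Require Import Defs.
From mathcomp Require Import all_boot all_order all_fingroup all_algebra all_solvable all_field.
From mathcomp Require Import complex.
From mathcomp Require Import all_classical all_reals all_analysis.
From mathcomp Require Import ring lra zify.
Import Order.TTheory GRing.Theory Num.Theory.
Import numFieldNormedType.Exports.
Local Open Scope classical_set_scope.
Local Open Scope ring_scope.

(** * The norm form of Z[eta], eta = (3 + sqrt 5) / 2 *)

(* The pair [(a, b)] stands for [a + b * eta], where [eta ^ 2 = 3 * eta - 1];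
   [eta] is the fundamental totally positive unit. *)
Definition eta_mul (x y : int * int) : int * int :=
  (x.1 * y.1 - x.2 * y.2, x.1 * y.2 + x.2 * y.1 + 3 * x.2 * y.2).
Definition eta_conj (x : int * int) : int * int := (x.1 + 3 * x.2, - x.2).
Definition eta_norm (x : int * int) : int := x.1 ^+ 2 + 3 * x.1 * x.2 + x.2 ^+ 2.
Definition cone (x : int * int) : Prop := 0 < x.1 /\ 0 <= x.2.

Lemma eta_mulA x y z : eta_mul x (eta_mul y z) = eta_mul (eta_mul x y) z.
Proof. by congr (_, _); rewrite /=; ring. Qed.

Lemma eta_mulC x y : eta_mul x y = eta_mul y x.
Proof. by congr (_, _); rewrite /=; ring. Qed.

Lemma eta_mul1 x : eta_mul (1, 0) x = x.
Proof. by case: x => a b; congr (_, _); rewrite /=; ring. Qed.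

Lemma eta_mul_conj x : eta_mul (eta_conj x) x = (eta_norm x, 0).
Proof. by congr (_, _); rewrite /eta_norm /=; ring. Qed.

Lemma eta_normM x y : eta_norm (eta_mul x y) = eta_norm x * eta_norm y.
Proof. by rewrite /eta_norm /=; ring. Qed.

Lemma eta_norm_conj x : eta_norm (eta_conj x) = eta_norm x.
Proof. by rewrite /eta_norm /=; ring. Qed.

Lemma eta_mulI x y z : eta_norm x != 0 -> eta_mul x y = eta_mul x z -> y = z.
Proof.
move=> xN0 /(congr1 (eta_mul (eta_conj x))); rewrite !eta_mulA eta_mul_conj.
case: y z => a b [c d] [] /=; rewrite !(mul0r, mulr0, subr0, addr0).
by move=> /(mulfI xN0) -> /(mulfI xN0) ->.
Qed.

(* Together with [cone_reduction]: the cone is a fundamental domain for the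
   totally positive elements modulo the powers of [eta]. *)
Lemma cone_unit_eq x u : cone x -> cone (eta_mul u x) -> eta_norm u = 1 -> eta_mul u x = x.
Proof.
move=> [x1 x2] []; move Ey : (eta_mul u x) => y y1 y2 uN.
have : eta_mul (eta_conj x) y = (eta_norm x * u.1, eta_norm x * u.2).
  rewrite -Ey (eta_mulC u) eta_mulA eta_mul_conj; congr (_, _); rewrite /=; ring.
have Nx : 0 < eta_norm x by rewrite /eta_norm; nia.
move=> [E1 E2].
have y11 := mulr_gt0 x1 y1; have y12 := mulr_ge0 (ltW x1) y2.
have y21 := mulr_ge0 x2 (ltW y1); have y22 := mulr_ge0 x2 y2.
(* Both [u] and its conjugate have positive first coordinate. Whichever of them has a nonnegative
   second coordinate lies in the cone, where norm 1 occurs only at [(1, 0)]. *)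
have U1 : 0 < u.1 by rewrite -(pmulr_rgt0 _ Nx) -E1; lia.
have U2 : 0 < u.1 + 3 * u.2.
  rewrite -(pmulr_rgt0 _ Nx) mulrDr mulrCA -E1 -E2; lia.
have [u1 u2] : u.1 = 1 /\ u.2 = 0.
  by move: uN U1 U2; rewrite /eta_norm; have [|] := lerP 0 u.2; nia.
by rewrite -Ey [u]surjective_pairing u1 u2 eta_mul1.
Qed.

(** The second hypothesis is positivity of the trace. Outside the cone, multiplying by [(0, 1)],
    which is [eta], or by [(3, -1)], which is its inverse [3 - eta], either lands in the cone or
    decreases [|x.1| + |x.2|]. *)
Lemma cone_reduction x : 0 < eta_norm x -> 0 < 2 * x.1 + 3 * x.2 ->
  exists2 u, eta_norm u = 1 & cone (eta_mul u x).
Proof.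
have [k] := ubnP (`|x.1| + `|x.2|)%N.
elim: k x => // k IH [a b] /= hk Nx Tx.
have step v : eta_norm v = 1 ->
  (exists2 u, eta_norm u = 1 & cone (eta_mul u (eta_mul v (a, b)))) ->
  exists2 u, eta_norm u = 1 & cone (eta_mul u (a, b)).
  move=> v1 [u u1 c]; exists (eta_mul u v); first by rewrite eta_normM u1 v1.
  by rewrite -eta_mulA.
rewrite /eta_norm /= in Nx.
have [a0|a0|a0] := ltrgtP a 0.
- have h : 3 * - a < 2 * b by nia.
  apply: (step (3, -1)) => //; apply: IH; rewrite /eta_norm /=; lia || nia.
- have [b0|b0] := ltP b 0; last by exists (1, 0); rewrite // eta_mul1.
  have h : 3 * - b < 2 * a by nia.
  apply: (step (0, 1)) => //; apply: IH; rewrite /eta_norm /=; lia || nia.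
- exists (3, -1) => //; split; rewrite /=; lia.
Qed.

(** Subtracting the first basis vector from the second gives the coefficients [B - 2A] and
    [A - B + C]; this keeps them positive. If [B >= A + C], the discriminant equation written in
    [C - A] and [B - A - C] would make 5 a square or exceed 5. *)
Lemma disc5_middle (A B C : int) : 0 < A -> A < C -> 0 < B ->
  B ^+ 2 = 4 * A * C + 5 -> 2 * A < B < A + C.
Proof.
move=> A0 AC B0 E; apply/andP; split; first by nia.
have d0 : 1 <= C - A by lia.
have E' : (C - A) ^+ 2 + 2 * (B - A - C) * (A + C) + (B - A - C) ^+ 2 = 5.
  by nia.
rewrite ltNge; apply/negP => h.
have [u0|u0] : B - A - C = 0 \/ 1 <= B - A - C by lia.
  rewrite u0 mulr0 mul0r expr0n !addr0 in E'.
  have [|] := lerP (C - A) 2; last by nia.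
  move=> h2; have [e|e] : C - A = 1 \/ C - A = 2 by lia.
    by rewrite e in E'.
  by rewrite e in E'.
by nia.
Qed.

(* A positive form (A, B, C) of discriminant 5 is reduced to (1, 3, 1), that is
   to the norm form itself, by subtracting one basis vector from the other. *)
Lemma eta_form_descent (A B C : int) : 0 < A -> 0 < B -> 0 < C ->
  B ^+ 2 = 4 * A * C + 5 -> exists x y : int * int,
  [/\ [/\ 0 <= x.1, 0 <= x.2, 0 <= y.1 & 0 <= y.2], eta_norm x = A, eta_norm y = C
    & B = 2 * x.1 * y.1 + 3 * (x.1 * y.2 + x.2 * y.1) + 2 * x.2 * y.2].
Proof.
have [k] := ubnP (`|A| + `|C|)%N.
elim: k A B C => // k IH A B C hk A0 B0 C0 E.
have [AC|CA|AC] := ltrgtP A C.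
- have /andP[h1 h2] := disc5_middle A B C A0 AC B0 E.
  have [|||||x [y [[x1 x2 y1 y2] ex ey e]]] := IH A (B - 2 * A) (A - B + C).
  + by lia.
  + by [].
  + by lia.
  + by lia.
  + by nia.
  exists x, (x.1 + y.1, x.2 + y.2); split => //=.
  + by split => //; lia.
  + move: ex ey e; rewrite /eta_norm /=; lia.
  + move: ex ey e; rewrite /eta_norm /=; lia.
- have E' : B ^+ 2 = 4 * C * A + 5 by nia.
  have /andP[h1 h2] := disc5_middle C B A C0 CA B0 E'.
  have [|||||x [y [[x1 x2 y1 y2] ex ey e]]] := IH (A - B + C) (B - 2 * C) C.
  + by lia.
  + by lia.
  + by lia.
  + by [].
  + by nia.
  exists (x.1 + y.1, x.2 + y.2), y; split => //=.
  + split => //; lia.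
  + move: ex ey e; rewrite /eta_norm /=; lia.
  + move: ex ey e; rewrite /eta_norm /=; lia.
- have [A1 B3] : A = 1 /\ B = 3.
    rewrite -AC in E; have h : 2 * A < B by nia.
    have : (B - 2 * A) * (B + 2 * A) = 5 by nia.
    nia.
  by exists (1, 0), (0, 1); rewrite -AC A1 B3.
Qed.

(** * Roots of [X^2 + X - 1] modulo a prime *)

Lemma pchar_fixed_natr (F : finFieldType) (p : nat) (w : F) :
  p \in [pchar F] -> w ^+ p = w -> exists k : nat, w = k%:R.
Proof.
move=> pF wp; have p_pr := pcharf_prime pF; have p_gt1 := prime_gt1 p_pr.
(* These [p] elements already exhaust the roots of [X^p - X]; a further fixed point of Frobenius
   would exceed the degree. *)
pose rs := [seq k%:R : F | k <- iota 0 p].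
have [/mapP[k _ ->]|wrs] := boolP (w \in rs); first by exists k.
have sizeq : size ('X^p - 'X : {poly F}) = p.+1.
  by rewrite size_polyDl ?size_polyN ?size_polyX ?size_polyXn.
have q0 : 'X^p - 'X != 0 :> {poly F} by rewrite -size_poly_eq0 sizeq.
have := @max_poly_roots _ _ (w :: rs) q0.
rewrite [size (w :: rs)]/= size_map size_iota sizeq ltnn => H; suff: false by []; apply: H.
  apply/allP => x; rewrite inE rootE !hornerE => /predU1P[->|].
    by rewrite wp subrr.
  by move=> /mapP[k _ ->]; rewrite -(pFrobenius_autE pF) pFrobenius_aut_nat subrr.
rewrite cons_uniq wrs map_inj_in_uniq ?iota_uniq // => i j; rewrite !mem_iota /= !add0n.
wlog ij : i j / (i <= j)%N => [H|_ jp].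
  by case: (leqP i j) => [/H//|/ltnW ji ip jp /esym e]; apply/esym/(H j i).
move=> /esym/eqP; rewrite -subr_eq0 -natrB // -(dvdn_pcharf pF) => d.
have [|/dvdn_leq/(_ d)] := posnP (j - i)%N; lia.
Qed.

(** As [X^2 + X - 1] has discriminant 5, this says that 5 is a square modulo [p]. The root is found
    in the field with [p^2] elements, which contains fifth roots of unity because [p^2 = 1] modulo
    5. *)
Lemma golden_root_mod (p : nat) : prime p -> kronecker5 p = 1 ->
  exists k : nat, (p%:Z %| k%:Z ^+ 2 + k%:Z - 1)%Z.
Proof.
move=> p_pr kp.
have p5 : (p %% 5 == 1)%N || (p %% 5 == 4)%N.
  move: kp; rewrite /kronecker5 !inE; do 2!case: ifP => //.
have [F pF cardF] := @pPrimePowerField p 2 p_pr isT.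
have d5 : (5 %| #|[set: {unit F}]%SET|)%N.
  rewrite card_finField_unit cardF; have := prime_gt1 p_pr.
  by case/orP: p5 => /eqP e _; have := divn_eq p 5; rewrite e; nia.
have [z _ oz] := Cauchy (isT : prime 5) d5.
set Z : F := val z.
(* For a primitive fifth root of unity [Z], the Gaussian period [Z + Z^-1] is a
   root of X^2 + X - 1; it is fixed by Frobenius because p = +-1 mod 5. *)
have Z5 : Z ^+ 5 = 1 by rewrite /Z -FinRing.val_unitX -oz expg_order.
have Zn1 : Z != 1.
  apply/eqP => Z1; suff z1 : z = 1%g by rewrite z1 order1 in oz.
  exact: val_inj.
have S : 1 + Z + Z ^+ 2 + Z ^+ 3 + Z ^+ 4 = 0.
  have : (Z - 1) * (1 + Z + Z ^+ 2 + Z ^+ 3 + Z ^+ 4) = 0 by ring: Z5.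
  by move=> /eqP; rewrite mulf_eq0 subr_eq0 (negbTE Zn1) => /eqP.
pose w := Z + Z ^+ 4.
have w2 : w ^+ 2 + w - 1 = 0.
  have -> : w ^+ 2 + w - 1 = (1 + Z + Z ^+ 2 + Z ^+ 3 + Z ^+ 4)
     + (Z ^+ 5 - 1) * (2 + Z ^+ 3) by rewrite /w; ring.
  by rewrite S Z5 subrr mul0r addr0.
have Zp n : Z ^+ n = Z ^+ (n %% 5).
  by rewrite {1}(divn_eq n 5) exprD mulnC exprM Z5 expr1n mul1r.
have wp : w ^+ p = w.
  rewrite -(pFrobenius_autE pF) /w pFrobenius_autD_comm ?pFrobenius_autE; last exact: mulrC.
  rewrite -exprM.
  rewrite (Zp p) (Zp (4 * p)%N) -modnMmr.
  by case/orP: p5 => /eqP ->; rewrite //= addrC.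
have [k wk] := pchar_fixed_natr _ _ _ pF wp.
exists k; have : (k ^ 2 + k + p.-1)%:R = 0 :> F.
  have := prime_gt0 p_pr => p0.
  rewrite !natrD natrX -wk -subn1 natrB // (pcharf0 pF) sub0r; exact: w2.
move=> /eqP; rewrite -(dvdn_pcharf pF) => /dvdnP [m e].
apply/dvdzP; exists (m%:Z - 1); have := prime_gt0 p_pr; nia.
Qed.

(** * Representations by a^2 + 3ab + b^2 *)

Definition eta_form (x : nat * nat) : nat := (x.1 ^ 2 + 3 * x.1 * x.2 + x.2 ^ 2)%N.

(** The diagonals [r = a + b <= n] suffice for norm [n], since [a^2 + 3ab + b^2 >= a + b]; the same
    [r] indexes the rows on the q-series side. *)
Definition cone_points (n : nat) : seq (nat * nat) :=
  [seq ((r - b)%N, b) | r <- iota 1 n, b <- iota 0 r].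

Definition reps (n : nat) : seq (nat * nat) :=
  [seq x <- cone_points n | eta_form x == n].

Definition toZ (x : nat * nat) : int * int := (x.1%:Z, x.2%:Z).

Lemma cone_points_uniq n : uniq (cone_points n).
Proof.
rewrite allpairs_uniq_dep ?iota_uniq // => [r _|]; first exact: iota_uniq.
move=> [r b] [s c] /allpairsPdep[r' [b' [_]]]; rewrite mem_iota => hb [-> eb].
move=> /allpairsPdep[s' [c' [_]]]; rewrite mem_iota => hc [-> ec] /= [e1 e2].
subst; have <- : r' = s' by lia.
by [].
Qed.

Lemma reps_uniq n : uniq (reps n).
Proof. by rewrite filter_uniq ?cone_points_uniq. Qed.

Lemma mem_cone_points n x :
  (x \in cone_points n) = (0 < x.1)%N && (x.1 + x.2 <= n)%N.
Proof.
apply/allpairsPdep/idP => [[r [b [] ]]|/andP[a0 h]].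
  rewrite !mem_iota => hr hb -> /=; lia.
exists (x.1 + x.2)%N, x.2; rewrite !mem_iota; split; try lia.
by case: x a0 h => a b /= a0 h; congr (_, _); lia.
Qed.

Lemma mem_reps n x : (x \in reps n) = (0 < x.1)%N && (eta_form x == n).
Proof.
rewrite mem_filter mem_cone_points andbC; case: eqP => [<-|]; last by rewrite !andbF.
rewrite !andbT; case: posnP => //= x0; rewrite /eta_form; nia.
Qed.

Lemma eta_norm_toZ x : eta_norm (toZ x) = (eta_form x)%:Z.
Proof. by rewrite /eta_norm /eta_form /toZ /=; lia. Qed.

Lemma repsP n x : reflect (cone (toZ x) /\ eta_norm (toZ x) = n%:Z) (x \in reps n).
Proof.
rewrite mem_reps eta_norm_toZ; apply: (iffP andP) => [[x0 /eqP ->]|[[x0 _] [->]]] //.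
Qed.

Lemma cone_toZ y : cone y -> exists x, y = toZ x.
Proof.
case: y => a b [/= a0 b0]; exists (`|a|%N, `|b|%N).
by rewrite /toZ /=; congr (_, _); lia.
Qed.

(** Compares two finite sets through a correspondence known only as a relation, such as equality up
    to a unit; choice supplies the injection. *)
Lemma leq_size_rel (T1 T2 : eqType) (E : T1 -> T2 -> Prop) (s : seq T1) (t : seq T2) :
  uniq s -> {in s, forall x, exists2 y, y \in t & E x y} ->
  {in s &, forall x x', forall y, E x y -> E x' y -> x = x'} -> (size s <= size t)%N.
Proof.
case: s => // x0 s; set s' := x0 :: s => us tot inj.
have [y0 _ _] := tot x0 (mem_head _ _).
have /choice[g gP] x : exists y, x \in s' -> y \in t /\ E x y.
  have [/tot[y]|] := boolP (x \in s'); first by exists y.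
  by exists y0.
rewrite -(size_map g); apply: uniq_leq_size => [|_ /mapP[x xs ->]].
  rewrite map_inj_in_uniq // => x x' xs xs' e.
  by apply: (inj _ _ xs xs' (g x)); [case: (gP _ xs)|rewrite e; case: (gP _ xs')].
by case: (gP _ xs).
Qed.

Lemma toZ_inj : injective toZ.
Proof. by case=> a b [c d] [-> ->]. Qed.

Lemma eta_unit_mulK u x : eta_norm u = 1 -> eta_mul (eta_conj u) (eta_mul u x) = x.
Proof. by move=> u1; rewrite eta_mulA eta_mul_conj u1 eta_mul1. Qed.

Lemma eta_mulCA x y z : eta_mul x (eta_mul y z) = eta_mul y (eta_mul x z).
Proof. by rewrite !eta_mulA (eta_mulC x). Qed.

Lemma cone_unit_unique u x y : eta_norm u = 1 -> cone (toZ x) -> cone (toZ y) ->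
  toZ y = eta_mul u (toZ x) -> x = y.
Proof.
move=> u1 cx cy e; apply: toZ_inj; rewrite e in cy *.
by rewrite (cone_unit_eq _ _ cx cy u1).
Qed.

Lemma mem_filter_reps (a : pred (nat * nat)) n x :
  (x \in [seq y <- reps n | a y]) = a x && (x \in reps n).
Proof. exact: mem_filter. Qed.

(** The second coordinate of [conj(y) * x]. If [y] has prime norm [p], divisibility of this
    coordinate forces that of the first, because [p] divides the norm of the product; then [y]
    divides [x]. *)
Definition eta_divides (p : nat) (y x : nat * nat) : bool :=
  (p%:Z %| x.2%:Z * y.1%:Z - x.1%:Z * y.2%:Z)%Z.

(* Multiplication by [y] followed by reduction into the cone is a bijection
   from the points of norm [n] onto the points of norm [p * n] divisible by [y]. *)
Lemma count_eta_divides (p : nat) y n : prime p -> (0 < n)%N -> y \in reps p ->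
  count (eta_divides p y) (reps (p * n)) = size (reps n).
Proof.
move=> p_pr n0 /repsP[[w1 w2] Nw]; have p0 := prime_gt0 p_pr.
rewrite -size_filter; set w := toZ y in w1 w2 Nw.
(* Equality up to a unit takes the place of an explicit reduction map into the cone. *)
pose E x z := exists2 u, eta_norm u = 1 & eta_mul w (toZ x) = eta_mul u (toZ z).
have Nw0 : eta_norm w != 0 by rewrite Nw; lia.
have V (x : nat * nat) : (eta_mul (eta_conj w) (toZ x)).2 = x.2%:Z * y.1%:Z - x.1%:Z * y.2%:Z.
  by rewrite /w /=; ring.
apply/eqP; rewrite eqn_leq; apply/andP; split.
- apply: (@leq_size_rel _ _ (fun z x => E x z)).
  + by rewrite filter_uniq ?reps_uniq.
  + move=> x; rewrite mem_filter_reps => /andP[/dvdzP[v2 e2] /repsP[[x1 x2] Nx]].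
    move: (V x); rewrite e2.
    case Ez : (eta_mul (eta_conj w) (toZ x)) => [z1 z2] /= e3; subst z2.
    have Nz : eta_norm (z1, v2 * p%:Z) = p%:Z ^+ 2 * n%:Z.
      by rewrite -Ez eta_normM eta_norm_conj Nw Nx PoszM; ring.
    have /dvdzP[v1 e1] : (p%:Z %| z1)%Z.
      suff : (p%:Z %| z1 ^+ 2)%Z by rewrite !dvdzE abszX Euclid_dvdX // => /andP[].
      apply/dvdzP; exists (p%:Z * n%:Z - 3 * z1 * v2 - v2 ^+ 2 * p%:Z).
      by move: Nz; rewrite /eta_norm /= ; lia.
    subst z1.
    have [||u u1 c] := cone_reduction (v1, v2).
    * move: Nz; rewrite /eta_norm /= => Nz.
      have : 0 < p%:Z ^+ 2 * n%:Z by rewrite mulr_gt0 // exprn_gt0.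
      by rewrite -Nz => h; nia.
    * rewrite /= -(@pmulr_lgt0 _ p%:Z) //; move: Ez w1 w2 x1 x2 => [].
      by rewrite /w /=; nia.
    have [x' ex'] := cone_toZ _ c.
    (* As [w] times its conjugate is [p], the equation [conj(w) x = p v] gives [p (w v) = p x], and
       [p] cancels. *)
    have ez : eta_mul w (v1, v2) = toZ x.
      apply: (@eta_mulI (p%:Z, 0)); first by rewrite /eta_norm /=; nia.
      rewrite eta_mulCA -[LHS]/(eta_mul w _).
      have -> : eta_mul (p%:Z, 0) (v1, v2) = (v1 * p%:Z, v2 * p%:Z).
        by congr (_, _); rewrite /=; ring.
      by rewrite -Ez eta_mulCA eta_mulA eta_mul_conj Nw.
    exists x'; last by exists u => //; rewrite -ex' eta_mulCA ez.
    apply/repsP; rewrite -ex'; split => //; rewrite eta_normM u1 mul1r.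
    apply: (mulfI Nw0); rewrite -eta_normM ez Nx Nw; lia.
  + move=> x x'; rewrite !mem_filter_reps => /andP[_ /repsP[cx _]] /andP[_ /repsP[cx' _]].
    move=> z [u u1 e] [v v1 e'].
    apply: (@cone_unit_unique (eta_mul (eta_conj v) u)) => //.
      by rewrite eta_normM eta_norm_conj u1 v1.
    by rewrite -eta_mulA -e e' eta_unit_mulK.
- apply: (leq_size_rel _ _ E); first exact: reps_uniq.
  + move=> x /repsP[[x1 x2] Nx].
    have Nz : eta_norm (eta_mul w (toZ x)) = (p * n)%:Z by rewrite eta_normM Nw Nx PoszM.
    have [||u u1 c] := cone_reduction (eta_mul w (toZ x)).
    * by rewrite Nz; nia.
    * by move: w1 w2 x1 x2; rewrite /w /=; nia.
    have [z ez] := cone_toZ _ c.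
    exists z; last by exists (eta_conj u); rewrite ?eta_norm_conj // -ez eta_unit_mulK.
    rewrite mem_filter_reps; apply/andP; split.
      rewrite /eta_divides -V -ez; apply/dvdzP; exists (eta_mul u (toZ x)).2.
      rewrite (eta_mulCA _ u) [X in eta_mul u X]eta_mulA eta_mul_conj Nw (eta_mulCA u).
      by rewrite [LHS]/= mul0r mulr0 mul0r !addr0 mulrC.
    by apply/repsP; rewrite -ez; split; rewrite // eta_normM u1 Nz mul1r.
  + move=> x x' /repsP[cx _] /repsP[cx' _] z [u u1 e] [v v1 e'].
    apply: (@cone_unit_unique (eta_mul v (eta_conj u))) => //.
      by rewrite eta_normM eta_norm_conj u1 v1.
    apply: (eta_mulI _ _ _ Nw0).
    by rewrite e' eta_mulCA -eta_mulA e eta_unit_mulK.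
Qed.

(** Scaling a point by [p] multiplies the form by [p^2], so the multiples of [p] of norm [pn] come
    from the points of norm [n / p]. *)
Lemma count_common_divisor (p n : nat) : prime p -> (0 < n)%N ->
  count (fun x => (p %| x.1) && (p %| x.2))%N (reps (p * n))
  = if (p %| n)%N then size (reps (n %/ p)) else 0%N.
Proof.
move=> p_pr n0; have p0 := prime_gt0 p_pr.
have fM a b : eta_form ((a * p)%N, (b * p)%N) = (p * (p * eta_form (a, b)))%N.
  by rewrite /eta_form /=; ring.
case: ifP => [/dvdnP[m e]|pn].
  rewrite e mulnK // -size_filter; subst n.
  apply/eqP; rewrite eqn_leq; apply/andP.
  pose E (x y : nat * nat) := y = ((x.1 * p)%N, (x.2 * p)%N).
  split.
    apply: (@leq_size_rel _ _ (fun y x => E x y)).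
    - by rewrite filter_uniq ?reps_uniq.
    - move=> x; rewrite mem_filter_reps mem_reps; case: x => x1 x2 /=.
      move=> /andP[/andP[/dvdnP[a ->] /dvdnP[b ->]]].
      rewrite fM muln_gt0 p0 andbT (mulnC m) !eqn_pmul2l // => h.
      by exists (a, b); rewrite ?mem_reps.
    - by move=> x x' _ _ y -> ->.
  apply: (leq_size_rel _ _ E); first exact: reps_uniq.
  - move=> [a b]; rewrite mem_reps /= => /andP[a0 /eqP e].
    exists ((a * p)%N, (b * p)%N) => //.
    rewrite mem_filter_reps mem_reps fM e /= !dvdn_mull // muln_gt0 a0 p0 /=.
    by rewrite (mulnC m).
  - move=> [a b] [a' b'] _ _ y -> [] /eqP; rewrite eqn_pmul2r // => /eqP -> /eqP.
    by rewrite eqn_pmul2r // => /eqP ->.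
apply/eqP; rewrite -leqn0 leqNgt -has_count; apply/hasPn => -[x1 x2].
rewrite mem_reps => /andP[_ /eqP e]; apply/negP => /= /andP[/dvdnP[a ea] /dvdnP[b eb]].
move: e; rewrite ea eb fM => /eqP; rewrite eqn_pmul2l // => /eqP e.
by rewrite -e dvdn_mulr in pn.
Qed.

(** The root yields a form of discriminant 5 with leading coefficient [p]; the descent expresses it
    through the norm form, so [p] is a norm. *)
Lemma reps_of_root_mod (p k : nat) : prime p -> (p%:Z %| k%:Z ^+ 2 + k%:Z - 1)%Z ->
  exists x : nat * nat, x \in reps p.
Proof.
move=> p_pr /dvdzP[m e]; have p1 := prime_gt1 p_pr.
have m0 : 0 <= m by nia.
(* The form [(p, 2k + 1, m)] has discriminant 5. Adding the first basis vector to the second gives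
   these coefficients, whose positivity follows from [0 <= m]. *)
have E : (2 * k%:Z + 1 + 2 * p%:Z) ^+ 2 = 4 * p%:Z * (m + 2 * k%:Z + 1 + p%:Z) + 5.
  have -> : (2 * k%:Z + 1 + 2 * p%:Z) ^+ 2
    = 4 * (k%:Z ^+ 2 + k%:Z - 1) + 4 * p%:Z * (2 * k%:Z + 1 + p%:Z) + 5 by ring.
  by rewrite e; ring.
have [|||x [y [[x1 x2 y1 y2] ex _ _]]] := eta_form_descent _ _ _ _ _ _ E; try lia.
have x10 : 0 < x.1.
  rewrite lt_neqAle x1 andbT; apply/negP => /eqP x10.
  have e2 : p = (`|x.2| ^ 2)%N.
    by move: ex; rewrite /eta_norm -x10 mulr0 mul0r expr0n !add0r; lia.
  have /primeP[_ /(_ `|x.2|%N)] := p_pr; rewrite {1}e2 dvdn_exp // => /(_ isT).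
  by case/orP => /eqP; nia.
have [x' e'] := cone_toZ x (conj x10 x2).
by exists x'; apply/repsP; rewrite -e'.
Qed.

(** The form equals [(a - b)^2] modulo 5, hence is never 2 or 3 there; the residues are checked one
    by one. *)
Lemma reps_kronecker5 n x : x \in reps n -> kronecker5 n != -1.
Proof.
rewrite mem_reps => /andP[_ /eqP <-]; case: x => a b.
have -> : kronecker5 (eta_form (a, b)) = kronecker5 (eta_form ((a %% 5)%N, (b %% 5)%N)).
  have H q r s t : eta_form ((q * 5 + r)%N, (s * 5 + t)%N) =
    ((5 * q ^ 2 + 2 * q * r + 3 * (5 * q * s + q * t + s * r)
    + 5 * s ^ 2 + 2 * s * t) * 5 + eta_form (r, t))%N by rewrite /eta_form /=; ring.
  by rewrite {1}(divn_eq a 5) {1}(divn_eq b 5) H /kronecker5 modnMDl.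
have := ltn_pmod a (isT : 0 < 5)%N; have := ltn_pmod b (isT : 0 < 5)%N.
by case: (a %% 5)%N => [|[|[|[|[|]]]]] //; case: (b %% 5)%N => [|[|[|[|[|]]]]].
Qed.

(** If [b] were invertible modulo [p], then [a / b + 1] would be a root of [X^2 + X - 1], and [p]
    would be a norm, against its residue modulo 5. *)
Lemma inert_dvd_eta_form p x : prime p -> kronecker5 p = -1 -> (p %| eta_form x)%N ->
  (p %| x.1)%N && (p %| x.2)%N.
Proof.
case: x => a b p_pr kp; have p0 := prime_gt0 p_pr.
rewrite /eta_form /= => pf.
have [pb|pb] := boolP (p %| b)%N.
  rewrite andbT; move: pf; rewrite dvdn_addl; last by rewrite dvdn_mulr.
  rewrite dvdn_addl; last by rewrite dvdn_mull.
  by rewrite Euclid_dvdX // => /andP[].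
have b0 : (0 < b)%N by case: b pb {pf}; rewrite ?dvdn0.
have /(coprimeP _ b0)[[u v] /= uv] : coprime b p by rewrite coprime_sym prime_coprime.
have [c ec] := dvdnP pf.
suff /reps_of_root_mod[//|x /reps_kronecker5] : (p%:Z %| (u * a).+1%:Z ^+ 2 + (u * a).+1%:Z - 1)%Z.
  by rewrite kp.
have uv' : u%:Z * b%:Z = 1 + v%:Z * p%:Z by lia.
have ec' : a%:Z ^+ 2 + 3 * a%:Z * b%:Z + b%:Z ^+ 2 = c%:Z * p%:Z by lia.
apply/dvdzP; exists (u%:Z ^+ 2 * c%:Z - 3 * u%:Z * a%:Z * v%:Z - 2 * v%:Z - v%:Z ^+ 2 * p%:Z).
have -> : (u * a).+1%:Z = u%:Z * a%:Z + 1 by lia.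
transitivity (u%:Z ^+ 2 * (c%:Z * p%:Z) - 3 * u%:Z * a%:Z * (v%:Z * p%:Z)
  - 2 * (v%:Z * p%:Z) - (v%:Z * p%:Z) ^+ 2); last by ring.
have -> : v%:Z * p%:Z = u%:Z * b%:Z - 1 by rewrite uv'; ring.
by rewrite -ec'; ring.
Qed.

(** * Divisor sums of the Kronecker symbol and the recurrence at a prime *)

Lemma kronecker5_eq0 p : prime p -> kronecker5 p = 0 -> p = 5%N.
Proof.
move=> p_pr kp; suff : (5 %| p)%N by rewrite dvdn_prime2 // => /eqP.
rewrite /dvdn; move: kp; rewrite /kronecker5; have := ltn_pmod p (isT : 0 < 5)%N.
by case: (p %% 5)%N => [|[|[|[|[|]]]]].
Qed.

Lemma kronecker5_cases n : [\/ kronecker5 n = 0, kronecker5 n = 1 | kronecker5 n = -1].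
Proof.
rewrite /kronecker5; case: ifP => _; first exact: Or32.
by case: ifP => _; [exact: Or33|exact: Or31].
Qed.

Lemma kronecker5M m n : kronecker5 (m * n) = kronecker5 m * kronecker5 n.
Proof.
rewrite /kronecker5 -modnMm; have := ltn_pmod m (isT : 0 < 5)%N.
have := ltn_pmod n (isT : 0 < 5)%N.
by case: (m %% 5)%N => [|[|[|[|[|]]]]] //; case: (n %% 5)%N => [|[|[|[|[|]]]]].
Qed.

Definition kronecker5_sum (n : nat) : int := \sum_(d <- divisors n) kronecker5 d.

Lemma sum_multiples_divisors p n : prime p -> (0 < n)%N ->
  \sum_(d <- divisors (p * n) | (p %| d)%N) kronecker5 d
  = kronecker5 p * kronecker5_sum n.
Proof.
move=> p_pr n0; have p0 := prime_gt0 p_pr.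
rewrite /kronecker5_sum big_distrr /=.
under [RHS]eq_bigr => d _ do rewrite -kronecker5M.
rewrite -[RHS](big_map (muln p) predT kronecker5) -big_filter; apply: perm_big.
apply: uniq_perm; first by rewrite filter_uniq ?divisors_uniq.
  by rewrite map_inj_uniq ?divisors_uniq // => x y /eqP; rewrite eqn_pmul2l // => /eqP.
move=> d; rewrite mem_filter -dvdn_divisors ?muln_gt0 ?p0 //.
apply/andP/mapP => [[/dvdnP[e ->]]|[e]].
  rewrite mulnC dvdn_pmul2l // => en; exists e => //.
  by rewrite -dvdn_divisors.
by rewrite -dvdn_divisors // => en ->; rewrite dvdn_mulr // dvdn_pmul2l.
Qed.

(** The divisors of [pn] prime to [p] are those of [n], and the others are [p] times the divisors of
    [n]. The subtracted term corrects for the divisors of [n] that are multiples of [p]. *)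
Lemma kronecker5_sum_rec p n : prime p -> (0 < n)%N ->
  kronecker5_sum (p * n) = (1 + kronecker5 p) * kronecker5_sum n
    - kronecker5 p * (if (p %| n)%N then kronecker5_sum (n %/ p) else 0).
Proof.
move=> p_pr n0; have p0 := prime_gt0 p_pr.
have split m : kronecker5_sum m = \sum_(d <- divisors m | (p %| d)%N) kronecker5 d
    + \sum_(d <- divisors m | ~~ (p %| d)%N) kronecker5 d.
  exact: bigID.
have -> : kronecker5 p * (if (p %| n)%N then kronecker5_sum (n %/ p) else 0)
    = \sum_(d <- divisors n | (p %| d)%N) kronecker5 d.
  case: ifP => [/dvdnP[m nE]|pn].
    rewrite nE mulnK // [in RHS]mulnC sum_multiples_divisors //.
    by move: n0; rewrite nE muln_gt0 => /andP[].
  rewrite mulr0 big_seq_cond big_pred0 // => d.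
  rewrite -dvdn_divisors //; apply/negP => /andP[dn pd].
  by rewrite (dvdn_trans pd dn) in pn.
rewrite (split (p * n)%N) sum_multiples_divisors // mulrDl mul1r addrC.
rewrite [in X in X + _ - _](split n) [X in X + _ - _]addrC.
suff -> : \sum_(d <- divisors (p * n) | ~~ (p %| d)%N) kronecker5 d
  = \sum_(d <- divisors n | ~~ (p %| d)%N) kronecker5 d by ring.
rewrite -!(big_filter _ (fun d => ~~ (p %| d)%N)); apply: perm_big; apply: uniq_perm.
- by rewrite filter_uniq ?divisors_uniq.
- by rewrite filter_uniq ?divisors_uniq.
move=> d; rewrite !mem_filter -!dvdn_divisors ?muln_gt0 ?p0 //.
have [//|pd] := boolP (p %| d)%N; rewrite /= Gauss_dvdr //.
by rewrite coprime_sym prime_coprime.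
Qed.

Lemma size_reps_rec p n : prime p -> (0 < n)%N ->
  (size (reps (p * n)))%:Z = (1 + kronecker5 p) * (size (reps n))%:Z
    - kronecker5 p * (if (p %| n)%N then (size (reps (n %/ p)))%:Z else 0).
Proof.
move=> p_pr n0; have p0 := prime_gt0 p_pr.
have := count_common_divisor p n p_pr n0.
have [kp|kp|kp] := kronecker5_cases p; rewrite kp.
- have e5 := kronecker5_eq0 p p_pr kp; subst p => _.
  rewrite addr0 !mul0r mul1r subr0; congr Posz.
  have y5 : (1, 1)%N \in reps 5 by rewrite mem_reps.
  (* The point [(1, 1)] is [1 + eta], of norm 5. It divides every point of norm [5n], because the
     form is [(b - a)^2] modulo 5. *)
  rewrite -(count_eta_divides 5 (1, 1)%N n p_pr n0 y5); apply/esym/eqP.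
  rewrite -all_count; apply/allP => -[a b]; rewrite mem_reps => /andP[_ /eqP e].
  rewrite /eta_divides /= !mulr1.
  have : (5%:Z %| (b%:Z - a%:Z) ^+ 2)%Z.
    by apply/dvdzP; exists (n%:Z - a%:Z * b%:Z); move: e; rewrite /eta_form /=; lia.
  by rewrite !dvdzE abszX Euclid_dvdX // => /andP[].
- have [k /reps_of_root_mod[//|[a b] yp]] := golden_root_mod p p_pr kp.
  have := mem_reps p (a, b); rewrite yp /= => /esym/andP[a0 /eqP fy].
  have p_neq2 : p != 2%N by apply: contra_eq_neq kp => ->.
  have b0 : (0 < b)%N.
    rewrite lt0n; apply: contraL p_pr => /eqP b0; rewrite -fy /eta_form /= b0 muln0 !addn0.
    apply/negP => /primeP[h /(_ a)]; rewrite dvdn_exp // => /(_ isT).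
    by case/orP => /eqP e; nia.
  have yp1 : (a < p)%N by move: fy; rewrite /eta_form /=; nia.
  have yp2 : (b < p)%N by move: fy; rewrite /eta_form /=; nia.
  have ndvd m : (0 < m < p)%N -> ~~ (p %| m)%N.
    by move=> /andP[m0 mp]; rewrite gtnNdvd.
    (* [(b, a)] is [eta] times the conjugate of [(a, b)], so it stands for the conjugate prime
       factor of [p]. *)
    have yp' : (b, a) \in reps p by rewrite mem_reps b0 -fy /eta_form /=; apply/eqP; ring.
  have Eu (u v : int) : (p%:Z %| u * v)%Z -> (p%:Z %| u)%Z \/ (p%:Z %| v)%Z.
    by rewrite !dvdzE abszM Euclid_dvdM // => /orP.
  have dbl : p != 2%N -> forall c : nat, (p%:Z %| 2 * c%:Z)%Z -> (p %| c)%N.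
    move=> p2 c /Eu[|]; rewrite dvdzE // => /dvdn_leq -/(_ isT).
    by have := prime_gt1 p_pr; lia.
  (* Here [p = (a + b)^2 + ab = (a - b)^2 + 5ab] with [a] and [b] strictly between 0 and [p], and
     [p] is not 5. So [p] divides neither [a + b] nor [a - b], which makes a point divisible by both
     prime factors a multiple of [p]. *)
  have nab : ~~ (p%:Z %| (a + b)%:Z)%Z.
    rewrite dvdzE /=; apply/negP => h; have : (p %| a * b)%N.
      rewrite -(dvdn_addr _ (dvdn_mulr (a + b) h)) -{1}fy /eta_form /=.
      by apply/dvdnP; exists 1%N; ring.
    by rewrite Euclid_dvdM // !(negbTE (ndvd _ _)) // ?a0 ?b0.
  have nab' : ~~ (p%:Z %| a%:Z - b%:Z)%Z.
    apply/negP => h; have : (p%:Z %| 5 * (a%:Z * b%:Z))%Z.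
      rewrite (_ : 5 * _ = p%:Z - (a%:Z - b%:Z) * (a%:Z - b%:Z)).
        by rewrite rpredB ?dvdzz ?dvdz_mulr.
      by move: fy; rewrite /eta_form /=; lia.
    case/Eu => [|/Eu[]]; rewrite dvdzE.
    - by rewrite /= dvdn_prime2 // => /eqP p5; rewrite p5 in kp.
    - by rewrite (negbTE (ndvd _ _)) ?a0.
    - by rewrite (negbTE (ndvd _ _)) ?b0.
  (* Inclusion-exclusion: each point of norm [pn] is divisible by one of the two conjugate factors,
     and those divisible by both are the multiples of [p]. *)
  have /eqP := count_predUI (eta_divides p (a, b)) (eta_divides p (b, a)) (reps (p * n)).
  rewrite !count_eta_divides //.
  have -> : count (predU (eta_divides p (a, b)) (eta_divides p (b, a))) (reps (p * n))
      = size (reps (p * n)).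
    apply/eqP; rewrite -all_count; apply/allP => -[c d].
    rewrite mem_reps => /andP[_ /eqP e]; apply/orP/Eu; rewrite /= .
    apply/dvdzP; exists (a%:Z * b%:Z * n%:Z - c%:Z * d%:Z).
    have e' : c%:Z ^+ 2 + 3 * c%:Z * d%:Z + d%:Z ^+ 2 = p%:Z * n%:Z.
      by move: e; rewrite /eta_form /=; lia.
    have f' : a%:Z ^+ 2 + 3 * a%:Z * b%:Z + b%:Z ^+ 2 = p%:Z.
      by move: fy; rewrite /eta_form /=; lia.
    transitivity (a%:Z * b%:Z * (p%:Z * n%:Z) - c%:Z * d%:Z * p%:Z); last by ring.
    by rewrite -e' -f'; ring.
  have -> : count (predI (eta_divides p (a, b)) (eta_divides p (b, a))) (reps (p * n)) =
      count (fun x => (p %| x.1) && (p %| x.2))%N (reps (p * n)).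
    apply: eq_in_count => -[c d] _; rewrite /eta_divides /=; apply/andP/andP => [[h1 h2]|[]].
      have h3 : (p%:Z %| (d%:Z - c%:Z) * (a%:Z + b%:Z))%Z.
        have -> : (d%:Z - c%:Z) * (a%:Z + b%:Z) =
          (d%:Z * a%:Z - c%:Z * b%:Z) + (d%:Z * b%:Z - c%:Z * a%:Z) by ring.
        exact: rpredD.
      have h4 : (p%:Z %| (d%:Z + c%:Z) * (a%:Z - b%:Z))%Z.
        have -> : (d%:Z + c%:Z) * (a%:Z - b%:Z) =
          (d%:Z * a%:Z - c%:Z * b%:Z) - (d%:Z * b%:Z - c%:Z * a%:Z) by ring.
        exact: rpredB.
      have {}h3 : (p%:Z %| d%:Z - c%:Z)%Z.
        by case: (Eu _ _ h3) => //; rewrite -PoszD (negbTE nab).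
      have {}h4 : (p%:Z %| d%:Z + c%:Z)%Z.
        by case: (Eu _ _ h4) => //; rewrite (negbTE nab').
      split; apply: (dbl p_neq2).
        have -> : 2 * c%:Z = d%:Z + c%:Z - (d%:Z - c%:Z) by ring.
        exact: rpredB.
      have -> : 2 * d%:Z = d%:Z + c%:Z + (d%:Z - c%:Z) by ring.
      exact: rpredD.
    by move=> pc pd; split; apply: rpredB; apply: dvdz_mulr; rewrite dvdzE.
  move=> /eqP e cb; rewrite cb in e; case: ifP e => _; lia.
- move=> cb; rewrite subrr mul0r mulN1r opprK add0r.
  have -> : size (reps (p * n)) = if (p %| n)%N then size (reps (n %/ p)) else 0%N.
    rewrite -cb; apply/esym/eqP; rewrite -all_count; apply/allP => x.
    rewrite mem_reps => /andP[_ /eqP e]; apply: inert_dvd_eta_form => //.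
    by rewrite e dvdn_mulr.
  by case: ifP.
Qed.

Theorem size_reps n : (0 < n)%N -> (size (reps n))%:Z = kronecker5_sum n.
Proof.
elim/ltn_ind: n => n IH n0; have [n1|n1] := leqP n 1.
  have -> : n = 1%N by lia.
  by rewrite /kronecker5_sum big_seq1.
have [p p_pr /dvdnP[m nE]] : exists2 p, prime p & (p %| n)%N.
  by exists (pdiv n); [exact: pdiv_prime|exact: pdiv_dvd].
have p1 := prime_gt1 p_pr.
have m0 : (0 < m)%N by move: n0; rewrite nE muln_gt0 => /andP[].
have mn : (m < n)%N by rewrite nE; nia.
have E : {in [pred k | (0 < k <= m)%N], forall k, (size (reps k))%:Z = kronecker5_sum k}.
  by move=> k /andP[k0 km]; apply: IH k0; exact: leq_ltn_trans mn.
have -> : n = (p * m)%N by rewrite nE mulnC.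
have := size_reps_rec p m p_pr m0; have := kronecker5_sum_rec p m p_pr m0.
rewrite (E m) ?inE ?m0 ?leqnn //.
case: ifP => [pm|_] -> ->; last reflexivity.
have mp : (0 < m %/ p <= m)%N.
  by rewrite leq_div andbT divn_gt0 ?(prime_gt0 p_pr) // dvdn_leq.
rewrite (E _ mp); reflexivity.
Qed.

(** * The q-series identity *)

Lemma bin2S n : 'C(n.+1, 2) = ('C(n, 2) + n)%N.
Proof. by rewrite binS bin1. Qed.

Lemma qpochS {F : fieldType} (q : F) k :
  qpoch q q k.+1 = qpoch q q k * (1 - q ^+ k.+1).
Proof. by rewrite /qpoch big_ord_recr /= -exprS. Qed.

Lemma qpoch0 {F : fieldType} (q : F) : qpoch q q 0 = 1.
Proof. by rewrite /qpoch big_ord0. Qed.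

(* [1 / (q; q)_(k - 1)], extended by 0 at [k = 0]. *)
Definition iqpoch {F : fieldType} (q : F) (k : nat) : F :=
  if k is k'.+1 then (qpoch q q k')^-1 else 0.

(** * The Bailey pair of the row sums *)

Definition hecke_row {F : fieldType} (q : F) (r : nat) : F :=
  \sum_(b < r) q ^+ (b * (r - b)).

(** Split off [b = 0] and shift the rest by one: [(b + 1)(r + 1 - b) = b(r - b) + (r + 1)]. *)
Lemma hecke_row_rec {F : fieldType} (q : F) r :
  hecke_row q r.+2 = 1 + q ^+ r.+1 * (1 + hecke_row q r).
Proof.
rewrite /hecke_row big_ord_recl /= mul0n expr0; congr (_ + _).
rewrite big_ord_recr /= mulrDr mulr1 addrC /bump /=; congr (_ + _).
  by congr (q ^+ _); lia.
rewrite mulr_sumr; apply: eq_bigr => b _; rewrite -exprD; congr (q ^+ _).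
have := ltn_ord b; nia.
Qed.

(** The coefficient of [Z s] is the difference of row [s + 1] and [q^s] times row [s - 1], which the
    recurrence makes elementary. Row sums survive only in the boundary terms. *)
Lemma hecke_row_by_parts {F : fieldType} (q : F) (Z : nat -> F) K :
  \sum_(s < K) hecke_row q s.+1 * (Z s - q ^+ s.+2 * Z s.+2)
  = \sum_(s < K) (if s == 0%N :> nat then 1 else 1 + q ^+ s) * Z s
    - (q ^+ K.+1 * hecke_row q K * Z K.+1 + q ^+ K * hecke_row q K.-1 * Z K).
Proof.
have row0 : hecke_row q 0 = 0 by rewrite /hecke_row big_ord0.
elim: K => [|K IH]; first by rewrite !big_ord0 row0; ring.
rewrite !big_ord_recr /= IH.
have -> : hecke_row q K.+1 = (if K == 0%N then 1 else 1 + q ^+ K) + q ^+ K * hecke_row q K.-1.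
  case: K {IH} => [|K] /=; last by rewrite hecke_row_rec; ring.
  by rewrite row0 /hecke_row big_ord1 mulr0 addr0.
by rewrite !exprS; move: (bigop _ _ _) (if _ then _ else _) => A c; ring.
Qed.

Lemma qpoch_neq0_factor {F : fieldType} (q : F) k :
  (forall k, qpoch q q k != 0) -> 1 - q ^+ k.+1 != 0.
Proof. by move=> /(_ k.+1); rewrite qpochS mulf_eq0 => /norP[]. Qed.

Lemma iqpochE {F : fieldType} (q : F) k : (forall k, qpoch q q k != 0) ->
  iqpoch q k = (1 - q ^+ k) * iqpoch q k.+1.
Proof.
move=> P0; case: k => [|k] /=; first by rewrite expr0 subrr mul0r.
rewrite qpochS; have := P0 k; have := qpoch_neq0_factor q k P0.
by move=> h1 h2; field; rewrite ?h1 ?h2.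
Qed.

(** At [J = N + 1] the sum vanishes: it is the q-binomial expansion of [(q^(-N-1); q)_(2N+2) = 0]
    with the terms [s] and [-s] folded together. The closed form for every [J] allows an
    induction. *)
Lemma gauss_partial_sum {F : fieldType} (q : F) N J :
  (forall k, qpoch q q k != 0) -> (J <= N.+1)%N ->
  \sum_(s < J.+1) (if s == 0%N :> nat then 1 else 1 + q ^+ s)
    * ((-1) ^+ s * q ^+ 'C(s, 2) * iqpoch q (N.+2 - s) / qpoch q q (N.+1 + s))
  = (-1) ^+ J * q ^+ 'C(J.+1, 2) * iqpoch q (N.+1 - J) / (qpoch q q (N.+1 + J) * (1 - q ^+ N.+1)).
Proof.
move=> P0; have N0 := qpoch_neq0_factor q N P0.
elim: J => [_|J IH JN].
  rewrite big_ord1 /= addn0 qpochS !bin_small // !expr0.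
  by have h := P0 N; field; rewrite h N0.
rewrite big_ord_recr /= IH; last exact: ltnW.
have [m Nm] : exists m, N = (J + m)%N by exists (N - J)%N; lia.
have -> : (N.+2 - J.+1 = m.+1)%N by lia.
have -> : (N.+1 - J = m.+1)%N by lia.
have -> : (N.+1 - J.+1 = m)%N by lia.
rewrite (iqpochE _ m P0) addnS qpochS (bin2S J.+1).
have h1 := P0 (N.+1 + J)%N; have h2 := qpoch_neq0_factor q (N.+1 + J) P0.
rewrite -addSn in h2.
move: h1 N0 h2; rewrite !addSn Nm !(exprS, exprD).
move: (qpoch _ _ _) (iqpoch _ _) => A B h1.
move: (q ^+ J) (q ^+ m) (q ^+ 'C(J.+1, 2)) ((-1) ^+ J) => v u w e N0 h2.
by field; rewrite h1 h2 N0.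
Qed.

(* The left-hand side is the increment in [n] of the summand of
   [qpoch_hecke_expansion], freed of its factor [hecke_row q s.+1]; the right-hand
   side has the shape to which [hecke_row_by_parts] applies. *)
Lemma hecke_certificate {F : fieldType} (q : F) s m : (forall k, qpoch q q k != 0) ->
  q ^+ s * (1 - q ^+ s.+1)
    * (qpoch q q (s + m).+1.*2 * iqpoch q m.+1 / qpoch q q (s + m + s).+2
       - (1 - q ^+ (s + m).+1) * (qpoch q q (s + m).*2 * iqpoch q m / qpoch q q (s + m + s).+1))
  = q ^+ (s + m) * (1 - q ^+ (s + m).+1) * qpoch q q (s + m).*2
    * (iqpoch q m.+1 / qpoch q q (s + m + s)
       - q ^+ (3 * s + 3) * iqpoch q m.-1 / qpoch q q (s + m + s).+2).
Proof.
move=> P0.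
have h := P0 (s + m + s)%N.
have h1 := qpoch_neq0_factor q (s + m + s) P0.
have h2 := qpoch_neq0_factor q (s + m + s).+1 P0.
rewrite doubleS !qpochS -addnn.
have -> : q ^+ (3 * s + 3) = q * q * q * q ^+ s * q ^+ s * q ^+ s.
  by rewrite exprD mulnC exprM; ring.
have E : iqpoch q m.-1 = (if m == 0%N then 0 else (1 - q ^+ m.-1) * (1 - q ^+ m) * iqpoch q m.+1).
  by case: m {h h1 h2} => //= m; rewrite (iqpochE q m P0) (iqpochE q m.+1 P0) mulrA.
rewrite E (iqpochE q m P0).
move: (qpoch q q (s + m + s)) (qpoch q q (s + m + (s + m))) (iqpoch q m.+1) h => A B I h.
case: m {E} h1 h2 => [|m] /=; rewrite ?addn0 ?addnS ?addSn => h1 h2.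
  move: h1 h2; rewrite !(exprS, exprD); move: (q ^+ s) => v h1 h2.
  by field; rewrite h h1 h2.
move: h1 h2; rewrite !(exprS, exprD); move: (q ^+ s) (q ^+ m) => v u h1 h2.
by field; rewrite h h1 h2.
Qed.

(** With [r = s + 1], by induction on the level: level [n + 2] minus [1 - q^(n+2)] times level
    [n + 1] vanishes. The certificate prepares each summand for summation by parts, which trades the
    row sums for the coefficients of the vanishing alternating sum. *)
Lemma qpoch_hecke_expansion {F : fieldType} (q : F) n : (forall k, qpoch q q k != 0) ->
  qpoch q q n.+1 = qpoch q q n.+1.*2 *
  \sum_(s < n.+1) (-1) ^+ s * (1 - q ^+ s.+1) * q ^+ 'C(s.+1, 2) * hecke_row q s.+1
    * (iqpoch q (n.+1 - s) / qpoch q q (n.+1 + s).+1).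
Proof.
move=> P0; elim: n => [|n IH].
  rewrite big_ord1 /= /hecke_row big_ord1 !qpochS qpoch0 !bin_small // !expr0.
  have h1 : 1 - q != 0 := qpoch_neq0_factor q 0 P0.
  have h2 := qpoch_neq0_factor q 1 P0.
  by field; rewrite h1 h2 oner_neq0.
(* The cut-off [M] is kept apart from the level [N] so that both levels run over the same range; the
   extra term [s = N] contains [iqpoch q 0 = 0]. *)
pose X N M := qpoch q q N.*2 *
  \sum_(s < M) (-1) ^+ s * (1 - q ^+ s.+1) * q ^+ 'C(s.+1, 2) * hecke_row q s.+1
    * (iqpoch q (N - s) / qpoch q q (N + s).+1).
have X1 : X n.+1 n.+2 = qpoch q q n.+1.
  by rewrite /X big_ord_recr /= subnn /= mul0r mulr0 addr0 -IH.
rewrite -/(X n.+2 n.+2) qpochS -X1; apply/eqP; rewrite mulrC -subr_eq0 -opprB oppr_eq0.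
apply/eqP; rewrite /X !mulr_sumr -sumrB.
pose t s := (-1) ^+ s * q ^+ 'C(s, 2) * iqpoch q (n.+2 - s) / qpoch q q (n.+1 + s).
pose c := q ^+ n.+1 * (1 - q ^+ n.+2) * qpoch q q n.+1.*2.
transitivity (c * \sum_(s < n.+2) hecke_row q s.+1 * (t s - q ^+ s.+2 * t s.+2)).
  rewrite mulr_sumr; apply: eq_bigr => s _; have sn := ltn_ord s.
  have [m nE] : exists m, (n.+1 = s + m)%N by exists (n.+1 - s)%N; lia.
  have C := @hecke_certificate F q s m P0.
  rewrite -nE in C.
  have -> : (n.+2 - s = m.+1)%N by lia.
  have -> : (n.+1 - s = m)%N by lia.
  rewrite /t /c.
  have -> : (n.+2 - s.+2 = m.-1)%N by lia.
  have -> : (n.+2 - s = m.+1)%N by lia.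
  (* [3s + 3] splits into the weight [s + 2] of the summation by parts and [2s + 1], the difference
     of ['C(s.+2, 2)] and ['C(s, 2)]. *)
  have e : q ^+ (3 * s + 3) = q ^+ s.+2 * (q ^+ s * q ^+ s.+1).
    by rewrite -!exprD; congr (q ^+ _); lia.
  pose K := (-1) ^+ s * q ^+ 'C(s, 2) * hecke_row q s.+1.
  transitivity (K * (q ^+ s * (1 - q ^+ s.+1)
    * (qpoch q q n.+2.*2 * iqpoch q m.+1 / qpoch q q (n.+1 + s).+2
       - (1 - q ^+ n.+2) * (qpoch q q n.+1.*2 * iqpoch q m / qpoch q q (n.+1 + s).+1)))).
    by rewrite /K bin2S exprD; ring.
  rewrite C // e /K !bin2S !exprD !addnS.
  by rewrite (exprS (-1)) (exprS (-1)); ring.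
(* The boundary terms contain [t] at [n.+2] and [n.+3], where truncated subtraction gives
   [iqpoch q 0 = 0]. *)
rewrite hecke_row_by_parts /t subnn /=.
have -> : (n.+2 - n.+3 = 0)%N by lia.
rewrite /= !(mulr0, mul0r, addr0, subr0).
have := @gauss_partial_sum F q n n.+1 P0 (leqnn _).
rewrite subnn /= !(mulr0, mul0r) => ->.
by rewrite mulr0.
Qed.

(* The summand of the conjugate Bailey pair, normalised to have total sum 1;
   [bailey_tail q j (M - j)], 0 <= j <= r, add up to the remainder left by
   truncating the sum at m + r < M. *)
Definition bailey_term {F : fieldType} (q : F) (r m : nat) : F :=
  (-1) ^+ m * q ^+ ('C(m.+1, 2) + r.+1 * m) * (1 - q ^+ r.+1) * qpoch q q (r + m)
    / (qpoch q q m * qpoch q q (m + r.*2).+2).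

Definition bailey_tail {F : fieldType} (q : F) (r k : nat) : F :=
  (-1) ^+ k * q ^+ ('C(k.+1, 2) + k * r.+1) * (1 - q ^+ r.*2.+1) * qpoch q q (r + k)
    / (qpoch q q k * qpoch q q (r.*2 + k).+1).

(** * Partial sums of the conjugate Bailey pair *)

Lemma bailey_sum0 {F : fieldType} (q : F) k : (forall k, qpoch q q k != 0) ->
  \sum_(m < k) bailey_term q 0 m = 1 - bailey_tail q 0 k.
Proof.
move=> P0; elim: k => [|k IH].
  rewrite big_ord0 /bailey_tail /= !qpochS qpoch0 bin_small // !expr0 expr1.
  have h1 : 1 - q != 0 := qpoch_neq0_factor q 0 P0.
  by field; rewrite h1.
rewrite big_ord_recr /= IH /bailey_term /bailey_tail !add0n double0 addn0 !qpochS (bin2S k.+1).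
have h1 := P0 k; have h2 := qpoch_neq0_factor q k P0.
have h3 := qpoch_neq0_factor q k.+1 P0.
move: 'C(k.+1, 2) => c; move: h2 h3; rewrite !mul1n !muln1 !(exprS, exprD) ?expr0 ?mulr1.
move: (qpoch _ _ _) h1 => A h1.
move: (q ^+ k) (q ^+ c) ((-1) ^+ k) => u w e h2 h3.
by field; rewrite h1 h2 h3.
Qed.

(** Lowering [r] by one lengthens the range of [m] by one and costs one tail, so [k + r] stays fixed
    and any [r] reduces to [r = 0]. Both sides have the same increment in [k]. *)
Lemma bailey_sumS {F : fieldType} (q : F) r k : (forall k, qpoch q q k != 0) ->
  \sum_(m < k) bailey_term q r.+1 m = \sum_(m < k.+1) bailey_term q r m - bailey_tail q r.+1 k.
Proof.
move=> P0; elim: k => [|k IH].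
  rewrite big_ord0 big_ord1 /bailey_term /bailey_tail /= doubleS ?add0n !addn0 ?muln0 ?mul0n ?addn0.
  rewrite ?expr0 !qpochS qpoch0.
  have h1 := P0 r; have h2 := P0 r.*2; have h3 := qpoch_neq0_factor q r.*2 P0.
  have h4 := qpoch_neq0_factor q r.*2.+1 P0; have h5 := qpoch_neq0_factor q r.*2.+2 P0.
  by field; rewrite ?h2 ?h3 ?h4 ?h5 ?oner_neq0.
rewrite big_ord_recr /= IH [in RHS]big_ord_recr /= -!addrA; congr (_ + _).
apply/eqP; rewrite -subr_eq0; apply/eqP.
rewrite /bailey_term /bailey_tail.
have -> : ('C(k.+1, 2) + r.+2 * k = 'C(k.+1, 2) + (r * k + k + k))%N by lia.
have -> : ('C(k.+2, 2) + r.+1 * k.+1 = 'C(k.+1, 2) + (r * k + k + k + r + 2))%N.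
  by rewrite bin2S; lia.
have -> : ('C(k.+2, 2) + k.+1 * r.+2 = 'C(k.+1, 2) + (r * k + k + k + k + r + 3))%N.
  by rewrite bin2S; lia.
have -> : ('C(k.+1, 2) + k * r.+2 = 'C(k.+1, 2) + (r * k + k + k))%N by lia.
move: 'C(k.+1, 2) => c; move: (r * k)%N => rk.
rewrite doubleS !addSn !addnS (addnC k) !qpochS.
have h1 := P0 k; have h2 := qpoch_neq0_factor q k P0.
have g1 := P0 (r.*2 + k)%N; have g2 := qpoch_neq0_factor q (r.*2 + k) P0.
have g3 := qpoch_neq0_factor q (r.*2 + k).+1 P0.
have g4 := qpoch_neq0_factor q (r.*2 + k).+2 P0.
have g5 := qpoch_neq0_factor q (r.*2 + k).+3 P0.
move: g1 h2 g2 g3 g4 g5; rewrite -addnn !(exprS, exprD).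
move: (qpoch q q k) (qpoch q q (r + r + k)) (qpoch q q (r + k)) h1 => A B C h1 g1.
move: (q ^+ k) (q ^+ r) (q ^+ c) (q ^+ rk) ((-1) ^+ k) => u v w z e h2 g2 g3 g4 g5.
by field; rewrite ?h1 ?h2 ?g1 ?g2 ?g3 ?g4 ?g5 ?oner_neq0.
Qed.

Lemma bin2D a b : ('C(a + b, 2) = 'C(a, 2) + 'C(b, 2) + a * b)%N.
Proof. by elim: b => [|b IH]; rewrite ?addn0 ?muln0 ?addn0 // addnS !bin2S IH; lia. Qed.

Lemma bin2_square a : ('C(a, 2) + 'C(a, 2) + a = a ^ 2)%N.
Proof. by elim: a => // a IH; rewrite bin2S; lia. Qed.

Lemma bailey_sum {F : fieldType} (q : F) r k : (forall k, qpoch q q k != 0) ->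
  \sum_(m < k) bailey_term q r m = 1 - \sum_(j < r.+1) bailey_tail q j (k + r - j).
Proof.
move=> P0; elim: r k => [|r IH] k; first by rewrite bailey_sum0 // big_ord1 addn0 subn0.
rewrite bailey_sumS // IH [in RHS]big_ord_recr /= addnK opprD addrA; congr (_ - _ - _).
by apply: eq_bigr => j _; rewrite addSnnS.
Qed.

Lemma sum_triangle {V : zmodType} (f : nat -> nat -> V) M :
  \sum_(n < M) \sum_(s < n.+1) f s (n - s)%N = \sum_(s < M) \sum_(m < M - s) f s m.
Proof.
elim: M => [|M IH]; first by rewrite !big_ord0.
rewrite big_ord_recr /= IH [RHS]big_ord_recr /= subSnn big_ord1.
rewrite [X in _ + X = _]big_ord_recr /= subnn addrA -big_split /=; congr (_ + _).
by apply: eq_bigr => s _; rewrite subSn ?big_ord_recr //; exact: ltnW.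
Qed.

Lemma qseries_partial_sum {F : fieldType} (q : F) M : (forall k, qpoch q q k != 0) ->
  \sum_(n < M) (-1) ^+ n * q ^+ 'C(n.+2, 2) * qpoch q q n.+1 * qpoch q q n
      / qpoch q q n.+1.*2
  = \sum_(s < M) q ^+ (s.+1 ^ 2) * hecke_row q s.+1
      * (1 - \sum_(j < s.+1) bailey_tail q j (M - j)).
Proof.
move=> P0.
(* The contribution of [r = s + 1] to the summand of index [n = s + m], counted from 0. *)
pose f s m := q ^+ (s.+1 ^ 2) * hecke_row q s.+1 * bailey_term q s m.
transitivity (\sum_(n < M) \sum_(s < n.+1) f s (n - s)%N).
  apply: eq_bigr => n _.
  transitivity ((-1) ^+ n * q ^+ 'C(n.+2, 2) * qpoch q q n
    * (qpoch q q n.+1 / qpoch q q n.+1.*2)); first by ring.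
  rewrite {1}(qpoch_hecke_expansion q n P0) [qpoch q q n.+1.*2 * _]mulrC mulfK //.
  rewrite mulr_sumr; apply: eq_bigr => s _; have := ltn_ord s.
  move: (nat_of_ord s) => {}s; move: (nat_of_ord n) => {}n sn.
  have [m nE] : exists m, (n = s + m)%N by exists (n - s)%N; lia.
  have -> : (n - s = m)%N by lia.
  have -> : (n.+1 - s = m.+1)%N by lia.
  rewrite /f /bailey_term nE /=.
  have -> : ((s + m).+1 + s = m + s.*2.+1)%N by rewrite -addnn; lia.
  have -> : q ^+ 'C((s + m).+2, 2) =
      q ^+ 'C(s.+1, 2) * q ^+ 'C(m.+1, 2) * (q ^+ (s.+1 * m) * q ^+ s.+1).
    rewrite -!exprD; congr (q ^+ _).
    by rewrite (_ : (s + m).+2 = s.+1 + m.+1)%N ?bin2D; nia.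
  have -> : q ^+ (s.+1 ^ 2) = q ^+ 'C(s.+1, 2) * q ^+ 'C(s.+1, 2) * q ^+ s.+1.
    by rewrite -!exprD -bin2_square.
  rewrite addnS [q ^+ ('C(m.+1, 2) + _)]exprD [(-1) ^+ (s + m)]exprD.
  have sgn : (-1) ^+ s * (-1) ^+ s = 1 :> F by rewrite -exprD addnn -signr_odd odd_double.
  rewrite invfM; move: (_ ^-1) (_ ^-1) => A B.
  transitivity (((-1) ^+ s * (-1) ^+ s) * ((-1) ^+ m * (q ^+ 'C(s.+1, 2) * q ^+ 'C(m.+1, 2) *
    (q ^+ (s.+1 * m) * q ^+ s.+1)) * qpoch q q (s + m) *
    ((1 - q ^+ s.+1) * q ^+ 'C(s.+1, 2) * hecke_row q s.+1 * (A * B)))).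
    move: ('C(_, _)) ('C(_, _)) (s.+1 * m)%N => ? ? ?; ring.
  rewrite sgn mul1r; move: ('C(_, _)) ('C(_, _)) (s.+1 * m)%N => ? ? ?; ring.
rewrite sum_triangle; apply: eq_bigr => s _; rewrite -mulr_sumr bailey_sum //.
congr (_ * (1 - _)); apply: eq_bigr => j _; rewrite subnK //.
by rewrite ltnW.
Qed.

(** * Estimates *)

(** The norm on [Cplx R] takes values in [Cplx R]; this is the same number as an element of [R],
    where the real estimates live. *)
Definition absC {R : realType} (z : Cplx R) : R := complex.Re `|z|.

Lemma absCE {R : realType} (z : Cplx R) : `|z| = (absC z)%:C%C.
Proof. by rewrite /absC normc_def. Qed.

Lemma absC_ge0 {R : realType} (z : Cplx R) : 0 <= absC z.
Proof. by rewrite -lecR -absCE normr_ge0. Qed.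

Lemma absCM {R : realType} (y z : Cplx R) : absC (y * z) = absC y * absC z.
Proof. by apply: complexI; rewrite rmorphM /= -!absCE normrM. Qed.

Lemma absCX {R : realType} (z : Cplx R) n : absC (z ^+ n) = absC z ^+ n.
Proof. by apply: complexI; rewrite rmorphXn /= -!absCE normrX. Qed.

Lemma absCV {R : realType} (z : Cplx R) : absC z^-1 = (absC z)^-1.
Proof. by apply: complexI; rewrite fmorphV /= -!absCE normfV. Qed.

Lemma absCN {R : realType} (z : Cplx R) : absC (- z) = absC z.
Proof. by apply: complexI; rewrite -!absCE normrN. Qed.

Lemma absC0 {R : realType} : absC (0 : Cplx R) = 0.
Proof. by apply: complexI; rewrite -absCE normr0. Qed.

Lemma absC1 {R : realType} : absC (1 : Cplx R) = 1.
Proof. by apply: complexI; rewrite -absCE normr1. Qed.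

Lemma absC_natr {R : realType} n : absC (n%:R : Cplx R) = n%:R.
Proof. by apply: complexI; rewrite -absCE normr_nat rmorph_nat. Qed.

Lemma absCD {R : realType} (y z : Cplx R) : absC (y + z) <= absC y + absC z.
Proof. by rewrite -lecR rmorphD /= -!absCE ler_normD. Qed.

Lemma absCB {R : realType} (y z : Cplx R) : absC (y - z) <= absC y + absC z.
Proof. by rewrite -(absCN z) absCD. Qed.

Lemma absC_sum {R : realType} (I : Type) (s : seq I) (P : pred I) (f : I -> Cplx R) :
  absC (\sum_(i <- s | P i) f i) <= \sum_(i <- s | P i) absC (f i).
Proof.
elim/big_ind2: _ => [|y a z b ha hb|//]; first by rewrite absC0.
by apply: le_trans (absCD _ _) _; exact: lerD.
Qed.

Lemma absC_sum_le {R : realType} (I : eqType) (s : seq I) (f : I -> Cplx R) (c : R) :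
  {in s, forall i, absC (f i) <= c} -> absC (\sum_(i <- s) f i) <= (size s)%:R * c.
Proof.
elim: s => [|i s IH] h; first by rewrite big_nil absC0 mul0r.
rewrite big_cons /= -natr1 mulrDl mul1r addrC; apply: le_trans (absCD _ _) _.
rewrite lerD //; last by rewrite h ?mem_head.
by apply: IH => k ks; rewrite h // inE ks orbT.
Qed.

Lemma cplx_cvg {R : realType} (u : nat -> Cplx R) (l : Cplx R) :
  (fun n => absC (u n - l)) @ \oo --> (0 : R) -> u @ \oo --> l.
Proof.
move=> h; apply/cvgrPdist_lt => e e0.
(* The radius [e] is a positive element of [Cplx R], hence real, so the comparison can be made in
   [R]. *)
have er : (complex.Re e)%:C%C = e by rewrite RRe_real // gtr0_real.
have Re0 : 0 < complex.Re e by rewrite -ltcR er.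
have /cvgrPdist_lt/(_ _ Re0) H := h.
near=> n; rewrite distrC absCE -er ltcR.
have : `|0 - absC (u n - l)| < complex.Re e by near: n.
by rewrite sub0r normrN ger0_norm ?absC_ge0.
Unshelve. all: by end_near.
Qed.

(** With [s] the fourth root of [x], [n^3 x^n = (n s^n)^3 s^n], and [n s^n] is at most
    [1 / (1 - s)]. *)
Lemma cube_geometric_bound {R : realType} (x : R) : 0 <= x < 1 ->
  exists C s : R, [/\ 0 <= C, 0 <= s < 1 & forall n : nat, n%:R ^+ 3 * x ^+ n <= C * s ^+ n].
Proof.
move=> /andP[x0 x1].
pose s := Num.sqrt (Num.sqrt x).
have s0 : 0 <= s by exact: sqrtr_ge0.
have s1 : s < 1 by rewrite -sqrtr1 ltr_sqrt // -[ltRHS]sqrtr1 ltr_sqrt.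
have s4 : x = s ^+ 4 by rewrite (exprM s 2 2) !sqr_sqrtr ?sqrtr_ge0.
have B n : n%:R * s ^+ n <= (1 - s)^-1.
  rewrite -[leRHS]mul1r ler_pdivlMr ?subr_gt0 //.
  have : n%:R * s ^+ n * (1 - s) <= 1 - s ^+ n; last by have := exprn_ge0 n s0; lra.
  elim: n => [|n IH]; first by rewrite mul0r mul0r subrr.
  have t1 : s ^+ n <= 1 by rewrite exprn_ile1 // ltW.
  rewrite exprS -natr1; move: IH t1 (exprn_ge0 n s0); move: (s ^+ n) (n%:R) => t m IH t1 t0.
  have h1 : s * (m * t * (1 - s)) <= s * (1 - t) by rewrite ler_wpM2l.
  have h2 : s * t * (1 - s) <= 1 - s.
    by rewrite ler_piMl ?subr_ge0 ?mulr_ile1 ?(ltW s1).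
  lra.
exists ((1 - s)^-1 ^+ 3), s; split.
- by rewrite exprn_ge0 // invr_ge0 subr_ge0 ltW.
- by rewrite s0.
move=> n; have -> : n%:R ^+ 3 * x ^+ n = (n%:R * s ^+ n) ^+ 3 * s ^+ n.
  by rewrite s4 -exprM mulnC exprM; move: (s ^+ n) (n%:R) => t m; ring.
apply: ler_wpM2r; first exact: exprn_ge0.
by rewrite lerXn2r // nnegrE ?invr_ge0 ?subr_ge0 ?(ltW s1) // mulr_ge0 // exprn_ge0.
Qed.

Lemma sum_geometric_le {R : realType} (x : R) n : 0 <= x < 1 ->
  \sum_(j < n) x ^+ j <= (1 - x)^-1.
Proof.
move=> /andP[x0 x1]; rewrite -[leRHS]mul1r ler_pdivlMr ?subr_gt0 //.
suff -> : (\sum_(j < n) x ^+ j) * (1 - x) = 1 - x ^+ n by have := exprn_ge0 n x0; lra.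
elim: n => [|n IH]; first by rewrite big_ord0 mul0r expr0 subrr.
by rewrite big_ord_recr /= mulrDl IH exprS; ring.
Qed.

(** Uses [1 + t <= exp t] factor by factor and then sums the geometric series. *)
Lemma prod_le_expR {R : realType} (x c : R) (b : nat -> R) n : 0 <= x < 1 -> 0 <= c ->
  (forall j, 0 <= b j <= 1 + c * x ^+ j) -> \prod_(j < n) b j <= expR (c * (1 - x)^-1).
Proof.
move=> xI c0 hb; apply: (@le_trans _ _ (expR (c * \sum_(j < n) x ^+ j))); last first.
  by rewrite ler_expR ler_wpM2l // sum_geometric_le.
elim: n => [|n IH]; first by rewrite !big_ord0 mulr0 expR0.
rewrite !big_ord_recr /= mulrDr expRD; have /andP[b0 b1] := hb n.
apply: ler_pM => //; first by apply: prodr_ge0 => j _; have /andP[] := hb j.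
exact: le_trans b1 (expR_ge1Dx _).
Qed.

Lemma absC_qpoch {R : realType} (q : Cplx R) n :
  absC (qpoch q q n) = \prod_(j < n) absC (1 - q ^+ j.+1).
Proof.
elim: n => [|n IH]; first by rewrite qpoch0 big_ord0 absC1.
by rewrite qpochS absCM IH big_ord_recr.
Qed.

Lemma absC_1Bexp_ge {R : realType} (q : Cplx R) n : absC q < 1 ->
  1 - absC q ^+ n.+1 <= absC (1 - q ^+ n.+1).
Proof.
move=> q1; rewrite lerBlDr -absCX -absC1; apply: le_trans (absCD _ _).
by rewrite subrK.
Qed.

Lemma absC_1Bexp_gt0 {R : realType} (q : Cplx R) n : absC q < 1 ->
  0 < absC (1 - q ^+ n.+1).
Proof.
move=> q1; apply: lt_le_trans (absC_1Bexp_ge q n q1).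
by rewrite subr_gt0 exprn_ilt1 ?absC_ge0.
Qed.

Lemma qpoch_neq0 {R : realType} (q : Cplx R) : absC q < 1 -> forall n, qpoch q q n != 0.
Proof.
move=> q1 n; apply/eqP => /(congr1 absC); rewrite absC0 absC_qpoch => /eqP.
by apply/negP; apply/prodf_neq0 => j _; rewrite gt_eqF // absC_1Bexp_gt0.
Qed.

(** Each factor and its inverse are at most [1 + c x^j] with [c = 1 / (1 - x)]; for the inverse,
    [c (1 - x^(j+1)) >= 1] absorbs the loss [x^(j+1) <= x^j]. *)
Lemma qpoch_bounded {R : realType} (q : Cplx R) : absC q < 1 ->
  exists2 K : R, 0 <= K &
    forall n, absC (qpoch q q n) <= K /\ absC (qpoch q q n)^-1 <= K.
Proof.
move=> q1; set x := absC q in q1 *; have x0 : 0 <= x := absC_ge0 q.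
have xI : 0 <= x < 1 by rewrite x0.
have y0 : 0 < 1 - x by rewrite subr_gt0.
pose c := (1 - x)^-1.
have c1 : 1 <= c by rewrite /c invf_ge1 // gerBl.
exists (expR (c * (1 - x)^-1)); first exact: expR_ge0.
move=> n; rewrite absCV absC_qpoch -prodfV; have c0 : 0 <= c := le_trans ler01 c1; split.
  apply: (@prod_le_expR _ x c (fun j => absC (1 - q ^+ j.+1))) => // j.
  rewrite absC_ge0 /=; apply: le_trans (absCB _ _) _.
  rewrite absC1 absCX -/x lerD2l exprS; apply: ler_wpM2r; first exact: exprn_ge0.
  exact: le_trans (ltW q1) c1.
apply: (@prod_le_expR _ x c (fun j => (absC (1 - q ^+ j.+1))^-1)) => // j.
rewrite invr_ge0 absC_ge0 /=.
have xj0 : 0 <= x ^+ j by exact: exprn_ge0.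
have h := absC_1Bexp_ge q j q1; rewrite -/x in h.
have g := absC_1Bexp_gt0 q j q1.
rewrite -[leLHS]mul1r ler_pdivrMr //.
have e : x ^+ j.+1 <= x by rewrite exprS ler_piMr // exprn_ile1 // ltW.
apply: (@le_trans _ _ ((1 + c * x ^+ j) * (1 - x ^+ j.+1))); last first.
  by rewrite ler_wpM2l // addr_ge0 // mulr_ge0 // (le_trans ler01).
have e2 : x ^+ j.+1 <= x ^+ j by rewrite exprS ler_piMl // ltW.
have e3 : x ^+ j <= c * x ^+ j * (1 - x ^+ j.+1).
  rewrite mulrAC ler_peMl // /c mulrC ler_pdivlMr // mul1r; lra.
lra.
Qed.

Lemma absC_ord_sum_le {R : realType} n (f : 'I_n -> Cplx R) (c : R) :
  (forall i, absC (f i) <= c) -> absC (\sum_i f i) <= n%:R * c.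
Proof.
move=> h; apply: le_trans (absC_sum _ _ _ _) _.
apply: (@le_trans _ _ (\sum_(i < n) c)); first exact: ler_sum.
by rewrite sumr_const card_ord mulr_natl.
Qed.

Lemma absCX_le {R : realType} (q : Cplx R) m n : absC q < 1 -> (m <= n)%N ->
  absC (q ^+ n) <= absC q ^+ m.
Proof. by move=> q1 mn; rewrite absCX ler_wiXn2l ?absC_ge0 // ltW. Qed.

Lemma absC_hecke_row {R : realType} (q : Cplx R) r : absC q < 1 ->
  absC (hecke_row q r) <= r%:R.
Proof.
move=> q1; rewrite -[leRHS]mulr1; apply: absC_ord_sum_le => b.
by rewrite -(expr0 (absC q)) absCX_le.
Qed.

(** * Distance of both partial sums from the sum over norms *)

Definition hecke_sum {R : realType} (q : Cplx R) M : Cplx R :=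
  \sum_(s < M) q ^+ (s.+1 ^ 2) * hecke_row q s.+1.

(** The tails with [j <= s] carry [|q|^(M - s)] and the row prefactor carries [|q|^(s + 1)],
    together at most [|q|^M]. The three factors [M] bound the number of rows, the size of a row and
    the number of tails; [2 K^3] bounds the rest of a tail. *)
Lemma qseries_error {R : realType} (q : Cplx R) : absC q < 1 ->
  exists2 c : R, 0 <= c & forall M,
  absC (\sum_(n < M) (-1) ^+ n * q ^+ 'C(n.+2, 2) * qpoch q q n.+1 * qpoch q q n
      / qpoch q q n.+1.*2 - hecke_sum q M) <= c * (M%:R ^+ 3 * absC q ^+ M).
Proof.
move=> q1; have [K K0 hK] := qpoch_bounded q q1.
have q0 := absC_ge0 q.
exists (2 * K ^+ 3) => [|M]; first by rewrite mulr_ge0 // exprn_ge0.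
rewrite qseries_partial_sum; last exact: qpoch_neq0.
rewrite /hecke_sum -sumrB.
apply: (@le_trans _ _ (M%:R * (M%:R * absC q ^+ M * (M%:R * (2 * K ^+ 3))))); last first.
  by rewrite le_eqVlt; apply/orP; left; apply/eqP; ring.
apply: absC_ord_sum_le => s.
rewrite mulrBr mulr1 addrAC subrr add0r absCN absCM.
have sM : (s < M)%N := ltn_ord s.
have tail (j : 'I_s.+1) : absC (bailey_tail q j (M - j)) <= absC q ^+ (M - s) * (2 * K ^+ 3).
  rewrite /bailey_tail invfM !absCM -!mulrA absCX absCN absC1 expr1n mul1r.
  apply: ler_pM; rewrite ?absC_ge0 ?mulr_ge0 ?absC_ge0 //.
    apply: absCX_le => //; have := ltn_ord j; nia.
  rewrite (_ : K ^+ 3 = K * (K * K)) //; apply: ler_pM; rewrite ?absC_ge0 ?mulr_ge0 ?absC_ge0 //.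
    apply: le_trans (absCB _ _) _; rewrite absC1 -[leRHS]/(1 + 1) lerD2l.
    by rewrite absCX exprn_ile1 // ltW.
  apply: ler_pM; rewrite ?absC_ge0 ?mulr_ge0 ?absC_ge0 //; first by case: (hK (j + (M - j))%N).
  by apply: ler_pM; rewrite ?absC_ge0 //; [case: (hK (M - j)%N)|case: (hK (j.*2 + (M - j)).+1)].
apply: (@le_trans _ _ ((M%:R * absC q ^+ s.+1) * (s.+1%:R * (absC q ^+ (M - s) * (2 * K ^+ 3))))).
  apply: ler_pM; rewrite ?absC_ge0 //; last exact: absC_ord_sum_le.
  rewrite absCM mulrC; apply: ler_pM; rewrite ?absC_ge0 //.
    by apply: le_trans (absC_hecke_row _ _ q1) _; rewrite ler_nat.
  by apply: absCX_le; rewrite // leq_pmulr.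
rewrite -!mulrA; apply: ler_wpM2l => //.
rewrite [leLHS]mulrCA [_ ^+ s.+1 * _]mulrA -exprD [leLHS]mulrCA.
apply: ler_pM; rewrite ?exprn_ge0 ?mulr_ge0 ?exprn_ge0 //.
  by rewrite ler_wiXn2l // ?(ltW q1) //; lia.
by apply: ler_wpM2r; rewrite ?mulr_ge0 ?exprn_ge0 // ler_nat.
Qed.

Definition reps_sum {R : realType} (q : Cplx R) M : Cplx R :=
  \sum_(1 <= m < M.+1) (size (reps m))%:R * q ^+ m.

Lemma hecke_sumE {R : realType} (q : Cplx R) M :
  hecke_sum q M = \sum_(x <- cone_points M) q ^+ eta_form x.
Proof.
rewrite /hecke_sum big_allpairs_dep /=.
have -> : iota 1 M = [seq s.+1 | s <- index_iota 0 M].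
  by rewrite /index_iota subn0; exact: (iotaDl 1 0 M).
rewrite big_map big_mkord; apply: eq_bigr => s _.
have -> : iota 0 s.+1 = index_iota 0 s.+1 by rewrite /index_iota subn0.
rewrite big_mkord mulr_sumr; apply: eq_bigr => b _; rewrite -exprD; congr (q ^+ _).
by have := ltn_ord b; rewrite /eta_form /=; nia.
Qed.

Lemma eta_form_gt0 x : (0 < x.1)%N -> (0 < eta_form x)%N.
Proof. by case: x => a b /= a0; rewrite /eta_form /=; nia. Qed.

Lemma perm_reps m M : (m <= M)%N ->
  perm_eq (reps m) [seq x <- cone_points M | eta_form x == m].
Proof.
move=> mM; apply: uniq_perm; rewrite ?filter_uniq ?cone_points_uniq // => x.
rewrite mem_reps mem_filter mem_cone_points; case: eqP => [e|_]; last by rewrite andbF.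
by rewrite andbT /=; case: posnP => //= x0; move: mM; rewrite -e /eta_form; nia.
Qed.

Lemma reps_sumE {R : realType} (q : Cplx R) M :
  reps_sum q M = \sum_(x <- cone_points M | (eta_form x <= M)%N) q ^+ eta_form x.
Proof.
rewrite /reps_sum.
transitivity (\sum_(1 <= m < M.+1) \sum_(x <- cone_points M | eta_form x == m) q ^+ eta_form x).
  apply: eq_big_nat => m /andP[m0 mM].
  rewrite (perm_size (perm_reps m M mM)) -big_filter size_filter.
  rewrite (eq_big_seq (fun=> q ^+ m)) => [|x]; last by rewrite mem_filter => /andP[/eqP ->].
  by rewrite big_const_seq count_predT size_filter iter_addr_0 mulr_natl.
rewrite (exchange_big_dep predT) //= [RHS]big_mkcond big_seq [RHS]big_seq.
apply: eq_bigr => x; rewrite mem_cone_points => /andP[x0 _].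
under eq_bigl => m do rewrite eq_sym.
rewrite big_nat1_eq ltnS; by rewrite eta_form_gt0.
Qed.

Lemma sumn_le (s : seq nat) c : all (fun k => k <= c)%N s -> (sumn s <= size s * c)%N.
Proof. by elim: s => //= k s IH /andP[kc sc]; rewrite mulSn leq_add // IH. Qed.

Lemma size_cone_points M : (size (cone_points M) <= M * M)%N.
Proof.
rewrite /cone_points size_allpairs_dep.
apply: leq_trans (sumn_le _ M _) _; last by rewrite size_map size_iota.
apply/allP => k /mapP[r hr ->]; move: hr; rewrite mem_iota size_iota; lia.
Qed.

(** The difference consists of the points with [a + b <= M] but norm above [M], of which there are
    at most [M^2]. *)
Lemma hecke_sum_error {R : realType} (q : Cplx R) M : absC q < 1 ->
  absC (hecke_sum q M - reps_sum q M) <= M%:R ^+ 2 * absC q ^+ M.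
Proof.
move=> q1; rewrite hecke_sumE reps_sumE (bigID (fun x => eta_form x <= M)%N) /= addrAC subrr add0r.
have q0 := exprn_ge0 M (absC_ge0 q).
rewrite -big_filter; apply: (@le_trans _ _ ((size (cone_points M))%:R * absC q ^+ M)); last first.
  by apply: ler_wpM2r; rewrite // -natrX ler_nat size_cone_points.
apply: (@le_trans _ _ ((size [seq x <- cone_points M | ~~ (eta_form x <= M)%N])%:R * absC q ^+ M)).
  apply: absC_sum_le => x; rewrite mem_filter -ltnNge => /andP[/ltnW h _].
  exact: absCX_le.
by apply: ler_wpM2r; rewrite // ler_nat size_filter count_size.
Qed.

Lemma sum_multiples {R : realType} (q : Cplx R) d M : (0 < d)%N ->
  (\sum_(1 <= m < M.+1 | (d %| m)%N) q ^+ m) * (1 - q ^+ d)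
  = q ^+ d - q ^+ (d * (M %/ d).+1).
Proof.
move=> d0; elim: M => [|M IH]; first by rewrite big_nil div0n muln1 mul0r subrr.
rewrite big_mkcond big_nat_recr //= -big_mkcond mulrDl IH divnS //.
case: ifP => [/dvdnP[k e]|_]; last by rewrite mul0r addr0.
have -> : (M %/ d = k.-1)%N.
  case: k e => [|k] e; first by rewrite mul0n in e.
  have -> : M = (k * d + d.-1)%N by move: e; rewrite mulSn; lia.
  by rewrite divnMDl // divn_small ?addn0 // prednK.
rewrite e; case: k e => [|k] e /=; first by rewrite mul0n in e.
by rewrite add1n !(mulnC d) [(k.+2 * d)%N]mulSn exprD; ring.
Qed.

(** By [size_reps], [reps_sum] is the Lambert series with each geometric series cut at exponent [M];
    the remainder for [d] starts at the first multiple of [d] above [M]. *)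
Lemma lambert_error {R : realType} (q : Cplx R) M : absC q < 1 ->
  absC (\sum_(1 <= n < M.+1) (kronecker5 n)%:~R * q ^+ n / (1 - q ^+ n) - reps_sum q M)
  <= M%:R * (absC q ^+ M / (1 - absC q)).
Proof.
move=> q1; have q0 := absC_ge0 q.
have -> : reps_sum q M = \sum_(1 <= d < M.+1) (kronecker5 d)%:~R *
    \sum_(1 <= m < M.+1 | (d %| m)%N) q ^+ m.
  under [RHS]eq_bigr => d _ do rewrite mulr_sumr big_mkcond /=.
  rewrite exchange_big_nat /=; apply: eq_big_nat => m /andP[m0 mM].
  rewrite -big_mkcond /= -mulr_suml; congr (_ * _).
  rewrite pmulrn size_reps // /kronecker5_sum rmorph_sum /= -[RHS]big_filter.
  apply: perm_big; apply: uniq_perm.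
  - exact: divisors_uniq.
  - by rewrite filter_uniq ?iota_uniq.
  move=> d; rewrite mem_filter mem_index_iota -dvdn_divisors //.
  case: (boolP (d %| m)%N) => //= dm; apply/esym.
  by rewrite (dvdn_gt0 m0 dm) ltnS (leq_trans (dvdn_leq m0 dm)).
rewrite -sumrB.
have {3}-> : M = size (index_iota 1 M.+1) by rewrite size_iota subn1.
apply: absC_sum_le => d; rewrite mem_index_iota => /andP[d0 dM].
case: d d0 dM => // d _ dM.
have d_neq0 : 1 - q ^+ d.+1 != 0.
  by apply/eqP => e; have := absC_1Bexp_gt0 q d q1; rewrite e absC0 ltxx.
have -> : \sum_(1 <= m < M.+1 | (d.+1 %| m)%N) q ^+ m
    = (q ^+ d.+1 - q ^+ (d.+1 * (M %/ d.+1).+1)) / (1 - q ^+ d.+1).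
  by rewrite -sum_multiples // mulfK.
rewrite -[_ * q ^+ d.+1 / _]mulrA -mulrBr -mulrBl opprB addrC subrK absCM.
rewrite -[leRHS]mul1r; apply: ler_pM; rewrite ?absC_ge0 //.
  by have [->|->|->] := kronecker5_cases d.+1; 
    rewrite ?rmorphN ?rmorph1 ?rmorph0 ?absCN ?absC0 ?absC1.
rewrite absCM absCV; apply: ler_pM; rewrite ?absC_ge0 ?invr_ge0 ?absC_ge0 //.
  by apply: absCX_le; rewrite // mulnC ltnW // ltn_ceil.
rewrite lef_pV2 ?posrE ?absC_1Bexp_gt0 ?subr_gt0 //.
apply: le_trans (absC_1Bexp_ge q d q1).
by rewrite lerD2l lerN2 exprS ler_piMr // exprn_ile1 // ltW.
Qed.

(** * Convergence of complex series *)

Lemma Re_le_absC {R : realType} (z : Cplx R) : `|complex.Re z| <= absC z.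
Proof. by rewrite -lecR -absCE; exact: normc_ge_Re. Qed.

Lemma Im_le_absC {R : realType} (z : Cplx R) : `|complex.Im z| <= absC z.
Proof.
rewrite /absC normc_def /= -sqrtr_sqr ler_wsqrtr // lerDr; exact: sqr_ge0.
Qed.

Lemma absC_le_ReIm {R : realType} (z : Cplx R) :
  absC z <= `|complex.Re z| + `|complex.Im z|.
Proof.
rewrite /absC normc_def /= -[leRHS]ger0_norm ?addr_ge0 // -sqrtr_sqr ler_wsqrtr //.
by rewrite sqrrD !real_normK ?num_real // lerD2r lerDl mulrn_wge0 // mulr_ge0.
Qed.

Lemma real_series_cvg {R : realType} (u : nat -> R) (c s : R) : 0 <= s < 1 ->
  (forall n, `|u n| <= c * s ^+ n) -> exists l : R, series u @ \oo --> l.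
Proof.
move=> /andP[s0 s1] h.
have H : cvgn (series u).
  apply: normed_cvg; apply: (@series_le_cvg _ _ (geometric c s)).
  - by move=> n; exact: normr_ge0.
  - by move=> n; exact: le_trans (normr_ge0 _) (h n).
  - exact: h.
  - by apply: is_cvg_geometric_series; rewrite ger0_norm.
by exists (limn (series u)).
Qed.

(** Real and imaginary parts are dominated by the same geometric series, so completeness of [R]
    gives both limits. *)
Lemma cplx_series_cvg {R : realType} (u : nat -> Cplx R) (c s : R) : 0 <= s < 1 ->
  (forall n, absC (u n) <= c * s ^+ n) ->
  exists l, (fun n => absC (\sum_(0 <= k < n) u k - l)) @ \oo --> (0 : R).
Proof.
move=> sI h.
have [a ha] := real_series_cvg (fun n => complex.Re (u n)) c s sI
  (fun n => le_trans (Re_le_absC _) (h n)).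
have [b hb] := real_series_cvg (fun n => complex.Im (u n)) c s sI
  (fun n => le_trans (Im_le_absC _) (h n)).
exists (Complex a b).
have SE n : \sum_(0 <= k < n) u k =
    Complex (series (fun n => complex.Re (u n)) n) (series (fun n => complex.Im (u n)) n).
  rewrite /series /=; elim: n => [|n IH]; first by rewrite !big_nil.
  by rewrite !big_nat_recr //= IH; case: (u n).
apply: (@squeeze_cvgr _ _ _ _ (fun=> 0)
  (fun n => `|series (fun n => complex.Re (u n)) n - a|
          + `|series (fun n => complex.Im (u n)) n - b|)).
- near=> n; rewrite absC_ge0 /=; apply: le_trans (absC_le_ReIm _) _.
  by rewrite SE.
- exact: cvg_cst.
- have dist0 (v : nat -> R) m : v @ \oo --> m -> `|v n - m| @[n --> \oo] --> (0 : R).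
    move=> hv; rewrite -(@normr0 _ R); apply: cvg_norm.
    by rewrite -[X in _ --> X](subrr m); apply: cvgB => //; exact: cvg_cst.
  by rewrite -[X in _ --> X]addr0; apply: cvgD; exact: dist0.
Unshelve. all: by end_near.
Qed.

Lemma cplx_cvg_close {R : realType} (u v : nat -> Cplx R) l (c s : R) : 0 <= s < 1 ->
  (forall n, absC (u n - v n) <= c * s ^+ n) ->
  (fun n => absC (v n - l)) @ \oo --> (0 : R) -> u @ \oo --> l.
Proof.
move=> /andP[s0 s1] h hv; apply: cplx_cvg.
apply: (@squeeze_cvgr _ _ _ _ (fun=> 0) (fun n => c * s ^+ n + absC (v n - l))).
- near=> n; rewrite absC_ge0 /=.
  have -> : u n - l = (u n - v n) + (v n - l) by rewrite addrA subrK.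
  by apply: le_trans (absCD _ _) _; rewrite lerD2r.
- exact: cvg_cst.
- rewrite -[X in _ --> X]addr0; apply: cvgD => //.
  rewrite -[X in _ --> X](mulr0 c); apply: cvgM; first exact: cvg_cst.
  by apply: cvg_expr; rewrite ger0_norm.
Unshelve. all: by end_near.
Qed.

Theorem theorem4p1 (R : realType) (q : Cplx R) (hq : `|q| < 1) :
  let lhs (n : nat) : Cplx R :=
    (-1) ^+ n.-1 * q ^+ 'C(n.+1, 2) * qpoch q q n * qpoch q q n.-1
      / qpoch q q n.*2 in
  let rhs (n : nat) : Cplx R :=
    (kronecker5 n)%:~R * q ^+ n / (1 - q ^+ n) in
  [/\ cvgn (fun N => \sum_(1 <= n < N) lhs n),
      cvgn (fun N => \sum_(1 <= n < N) rhs n)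
    & limn (fun N => \sum_(1 <= n < N) lhs n)
      = limn (fun N => \sum_(1 <= n < N) rhs n)].
Proof.
move=> lhs rhs.
have q1 : absC q < 1 by rewrite -ltcR -absCE.
have q0 := absC_ge0 q.
have [C [s [C0 sI B]]] := cube_geometric_bound (absC q) (introT andP (conj q0 q1)).
have cubic (n : nat) : n%:R <= n%:R ^+ 3 :> R.
  by rewrite -natrX ler_nat; case: n => // n; rewrite expnS leq_pmulr // expn_gt0.
have square (n : nat) : n%:R ^+ 2 <= n%:R ^+ 3 :> R.
  by rewrite -!natrX ler_nat; case: n => // n; rewrite leq_pexp2l.
have size_reps_le m : (size (reps m) <= m ^ 2)%N.
  by apply: leq_trans (size_cone_points m); rewrite size_filter count_size.
have term_le m : absC ((size (reps m))%:R * q ^+ m) <= C * s ^+ m.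
  apply: le_trans (B m); rewrite absCM absC_natr absCX ler_wpM2r ?exprn_ge0 //.
  by apply: le_trans (square m); rewrite -natrX ler_nat.
have [l hl] : exists l, (fun M => absC (reps_sum q M - l)) @ \oo --> (0 : R).
  have [l hl] := cplx_series_cvg _ C s sI term_le.
  exists l; have -> : (fun M => absC (reps_sum q M - l)) = (fun M =>
      absC (\sum_(0 <= m < M.+1) (size (reps m))%:R * q ^+ m - l)).
    (* The term at [m = 0] vanishes because [reps 0] is empty. *)
    by apply: funext => M; rewrite [in RHS]big_ltn //= mul0r add0r.
  by move: hl; rewrite -cvg_shiftS.
have [c c0 hc] := qseries_error q q1.
have cvgl : (fun N => \sum_(1 <= n < N) lhs n) @ \oo --> l.
  rewrite -cvg_shiftS.
  apply: (cplx_cvg_close _ (reps_sum q) l ((c + 1) * C) s sI _ hl) => M.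
  rewrite -[absC _]/(absC (\sum_(1 <= n < M.+1) lhs n - reps_sum q M)).
  have -> : \sum_(1 <= n < M.+1) lhs n = \sum_(n < M) (-1) ^+ n * q ^+ 'C(n.+2, 2)
      * qpoch q q n.+1 * qpoch q q n / qpoch q q n.+1.*2.
    by rewrite big_add1 big_mkord.
  (* Pass through [hecke_sum q M]; the errors [c M^3 |q|^M] and [M^2 |q|^M] are then both under the
     geometric bound. *)
  rewrite -(subrK (hecke_sum q M) (bigop _ _ _)) -addrA.
  apply: le_trans (absCD _ _) _.
  apply: le_trans (lerD (hc M) (hecke_sum_error q M q1)) _.
  rewrite -mulrA mulrDl mul1r; apply: lerD; first exact: ler_wpM2l.
  by apply: le_trans (B M); apply: ler_wpM2r; rewrite // exprn_ge0.
have cvgr : (fun N => \sum_(1 <= n < N) rhs n) @ \oo --> l.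
  rewrite -cvg_shiftS.
  apply: (cplx_cvg_close _ (reps_sum q) l ((1 - absC q)^-1 * C) s sI _ hl) => M.
  apply: le_trans (lambert_error q M q1) _.
  rewrite mulrA mulrC -mulrA; apply: ler_wpM2l; first by rewrite invr_ge0 subr_ge0 ltW.
  by apply: le_trans (B M); apply: ler_wpM2r; rewrite // exprn_ge0.
split; [by apply/cvg_ex; exists l|by apply/cvg_ex; exists l|].
by rewrite (cvg_lim (@norm_hausdorff _ _) cvgl) (cvg_lim (@norm_hausdorff _ _) cvgr).
Qed.
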